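(* For each integer $m\ge 2$ there is a neighborhood $U_m$ of $0$ in $\mathbb{R}^{m-1}$ such that the following statements hold (for each choice of sign $\pm$). (i) The generating functions $H^{\pm}_m(x,h)$ are defined (i.e. their defining series converge absolutely) whenever $x\in\mathbb{R}^m$, $|x|_m\le 1$ and $h\in U_m$. (ii) For each $k=(k_2,\ldots,k_m)\in\mathbb{N}_0^{m-1}$ and each $x\in\mathbb{R}^m$ with $|x|_m\le 1$, $$harm_k^{\pm}(x)=\frac{1}{k!}\,\partial^{k}H^{\pm}_m(x,h)\Big|_{h=0},$$ where $k!=(k_2!)\cdots(k_m!)$ and $\partial^k=\partial_{h_2}^{k_2}\cdots\partial_{h_m}^{k_m}$. (iii) If $m\ge 3$, $|x|_m\le 1$ and $h\in U_m$, then $$H^{\pm}_m(x,h)=d_m^{\,1-\frac m2}\,H^{\pm}_{m-1}(\underline{x},\underline{h}/d_m),$$ where $d_m=1-2x_mh_m+h_m^2|x|_m^2$, $\underline{x}=(x_1,\ldots,x_{m-1})$ and $\underline{h}/d_m=(h_2/d_m,\ldots,h_{m-1}/d_m)$.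
   Context: $\mathbb{N}_0=\{0,1,2,\ldots\}$. For $x=(x_1,\ldots,x_m)\in\mathbb{R}^m$ put $|x|_m=\sqrt{x_1^2+\cdots+x_m^2}$. For $\nu>0$, the Gegenbauer polynomials $C^\nu_k$ are determined by $\frac{1}{(1-2th+h^2)^\nu}=\sum_{k=0}^\infty C^\nu_k(t)h^k$ for $|t|\le1$, $|h|<1$. For $m\ge3$ and $n,j\in\mathbb{N}_0$ define the embedding factors $$F^{(n)}_{m,j}(x)=|x|_m^{n}\,C^{m/2+j-1}_{n}(x_m/|x|_m),\quad x\in\mathbb{R}^m,$$ which are polynomials in $x$ (the value at $x=0$ is that of the polynomial; in particular $F^{(0)}_{m,j}=1$). When $F^{(n)}_{r,j}$ with $3\le r\le m$ is applied to $x\in\mathbb{R}^m$, it is evaluated at $(x_1,\ldots,x_r)$. For $k_2\in\mathbb{N}_0$ let $harm_{k_2}^{\pm}(x_1,x_2)=(x_1\pm ix_2)^{k_2}/(k_2!)$. For $m\ge 2$ and $k=(k_2,\ldots,k_m)\in\mathbb{N}_0^{m-1}$ let $$harm_k^{\pm}(x)=harm_{k_2}^{\pm}(x_1,x_2)\prod_{r=3}^m F^{(k_r)}_{r,k^*_{r-1}}(x),\qquad k^*_r=k_2+\cdots+k_r$$ (for $m=2$ the product is empty). For $x\in\mathbb{R}^m$ and $h=(h_2,\ldots,h_m)\in\mathbb{R}^{m-1}$, the generating function is $$H^{\pm}_m(x,h)=\sum_{k\in\mathbb{N}_0^{m-1}}harm_k^{\pm}(x)\,h^k,\qquad h^k=h_2^{k_2}\cdots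 h_m^{k_m},$$ defined whenever the series converges absolutely. *)

(* Defs.v *)
From mathcomp Require Import all_boot all_order all_algebra.
From mathcomp Require Import all_classical all_reals all_analysis.
From mathcomp Require Import complex.

Set Implicit Arguments.
Unset Strict Implicit.
Unset Printing Implicit Defensive.

Import Order.TTheory GRing.Theory Num.Theory.
Import numFieldNormedType.Exports.

Local Open Scope classical_set_scope.
Local Open Scope ring_scope.
Local Open Scope complex_scope.

(* Indexing: points of R^m with m >= 2 are x : 'rV[R]_n.+2 with m = n.+2, and
   x_r is stored at the ordinal r - 1.  The vectors h = (h_2, ..., h_m) and the
   multi-indices k = (k_2, ..., k_m) are indexed by 'I_n.+1, and h_r, k_r are
   stored at the ordinal r - 2.  The sign +/- is the boolean s, read as
   (-1) ^+ s. *)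

Definition is_gegenbauer_family (R : realType) (nu : R) (C : nat -> {poly R}) :=
  forall t h : R, `|t| <= 1 -> `|h| < 1 ->
    series (fun k => (C k).[t] * h ^+ k) @ \oo
      --> ((1 - 2 * t * h + h ^+ 2) `^ nu)^-1.

(* The generating function determines the family; [xget] returns it. *)
Definition gegenbauer (R : realType) (nu : R) : nat -> {poly R} :=
  xget (fun=> 0) [set C | is_gegenbauer_family nu C].

Definition enorm (R : realType) (n : nat) (x : 'rV[R]_n) : R :=
  Num.sqrt (\sum_i x 0 i ^+ 2).

(* The first r coordinates of x; meaningful for r <= n.+1. *)
Definition prefix_row (R : realType) (n r : nat) (x : 'rV[R]_n.+1) : 'rV[R]_r :=
  \row_(i < r) x 0 (inord i).

(* F^(n)_{m,j} for m = p.+1.  At y = 0 this is 0 ^+ n * C_n(0 / 0), that is 1 if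
   n = 0 and 0 otherwise: the value at 0 of the homogeneous polynomial of
   degree n, as required. *)
Definition embed_factor (R : realType) (p j n : nat) (y : 'rV[R]_p.+1) : R :=
  enorm y ^+ n *
  (gegenbauer (p.+1%:R / 2 + j%:R - 1) n).[y 0 ord_max / enorm y].

Definition harm2 (R : realType) (s : bool) (k2 : nat) (x1 x2 : R) : R[i] :=
  (x1 +i* ((-1) ^+ s * x2)) ^+ k2 / k2`!%:R.

(* The factor with index i is the one with r = i.+2; the inner sum is
   k_2 + ... + k_(r-1). *)
Definition harm (R : realType) (n : nat) (s : bool)
    (k : {ffun 'I_n.+1 -> nat}) (x : 'rV[R]_n.+2) : R[i] :=
  harm2 s (k ord0) (x 0 ord0) (x 0 (lift ord0 ord0)) *
  \prod_(i < n.+1 | (0 < i)%N)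
    (embed_factor (\sum_(j < n.+1 | (j < i)%N) k j)%N (k i)
       (prefix_row i.+2 x))%:C.

Definition mpow (R : realType) (n : nat) (h : 'rV[R]_n)
    (k : {ffun 'I_n -> nat}) : R :=
  \prod_i h 0 i ^+ k i.

Definition mfact (n : nat) (k : {ffun 'I_n -> nat}) : nat :=
  (\prod_i (k i)`!)%N.

Definition abs_summable (R : realType) (I : choiceType) (u : I -> R[i]) : Prop :=
  summable [set: I] (fun k => (ComplexField.Normc.normc (u k))%:E).

(* Unordered sums, meant for absolutely summable families. *)
Definition rsum (R : realType) (I : choiceType) (u : I -> R) : R :=
  fine (\esum_(k in [set: I]) (Num.max (u k) 0)%:E) -
  fine (\esum_(k in [set: I]) (Num.max (- u k) 0)%:E).

Definition csum (R : realType) (I : choiceType) (u : I -> R[i]) : R[i] :=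
  rsum (fun k => complex.Re (u k)) +i* rsum (fun k => complex.Im (u k)).

Definition gen_term (R : realType) (n : nat) (s : bool)
    (x : 'rV[R]_n.+2) (h : 'rV[R]_n.+1) (k : {ffun 'I_n.+1 -> nat}) : R[i] :=
  harm s k x * (mpow h k)%:C.

Definition gen_defined (R : realType) (n : nat) (s : bool)
    (x : 'rV[R]_n.+2) (h : 'rV[R]_n.+1) : Prop :=
  abs_summable (gen_term s x h).

Definition gen_fun (R : realType) (n : nat) (s : bool)
    (x : 'rV[R]_n.+2) (h : 'rV[R]_n.+1) : R[i] :=
  csum (gen_term s x h).

(* The head of the list of directions is the partial derivative applied last. *)
Fixpoint pderivs (R : realType) (n : nat) (f : 'rV[R]_n -> R) (l : seq 'I_n)
    : 'rV[R]_n -> R :=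
  if l is i :: l' then
    fun a => 'D_(delta_mx 0 i) (pderivs f l' : 'rV[R]_n -> R^o) a
  else f.

(* [derive] is total, so existence is stated separately: each partial derivative
   but the last exists near the point, and the last one exists at the point. *)
Fixpoint pderivable (R : realType) (n : nat) (f : 'rV[R]_n -> R) (l : seq 'I_n)
    (a : 'rV[R]_n) : Prop :=
  if l is i :: l' then
    (\forall b \near a, pderivable f l' b) /\
    derivable (pderivs f l' : 'rV[R]_n -> R^o) a (delta_mx 0 i)
  else True.

(* [:: 0; ..; 0; 1; ..; 1; ...] with i repeated k i times, so that the first
   variable is differentiated last. *)
Definition mdirs (n : nat) (k : {ffun 'I_n -> nat}) : seq 'I_n :=
  flatten [seq nseq (k i) i | i <- enum 'I_n].

Definition mpderivable (R : realType) (n : nat) (k : {ffun 'I_n -> nat})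
    (f : 'rV[R]_n -> R[i]) (a : 'rV[R]_n) : Prop :=
  pderivable (fun h => complex.Re (f h)) (mdirs k) a /\
  pderivable (fun h => complex.Im (f h)) (mdirs k) a.

Definition mpderiv (R : realType) (n : nat) (k : {ffun 'I_n -> nat})
    (f : 'rV[R]_n -> R[i]) (a : 'rV[R]_n) : R[i] :=
  pderivs (fun h => complex.Re (f h)) (mdirs k) a +i*
  pderivs (fun h => complex.Im (f h)) (mdirs k) a.

Definition gen_denom (R : realType) (n : nat)
    (x : 'rV[R]_n.+2) (h : 'rV[R]_n.+1) : R :=
  1 - 2 * x 0 ord_max * h 0 ord_max + h 0 ord_max ^+ 2 * enorm x ^+ 2.

(* Main.v *)
(* Summing harm_k(x) h^k over the last index k_m first gives, by the generating
   function of the Gegenbauer polynomials with t = x_m / |x| at |x| h_m, the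
   factor d_m^-(m/2 - 1 + k_2 + ... + k_(m-1)); its part depending on k is
   absorbed by rescaling h, whence (iii) by Fubini for absolutely convergent
   sums.  The same computation with |C_n(t)| <= C_n(1) bounds the sum of the
   absolute values over k_m by a constant times 4^(k_2 + ... + k_(m-1)) when
   |h_m| <= 1/2, so that (i) follows by induction on m on polydiscs of radius
   4^(2 - m) / 2.  Part (ii) is termwise differentiation of a power series that
   converges absolutely on a polydisc. *)
Require Import Defs.
From mathcomp Require Import all_boot all_order all_algebra.
From mathcomp Require Import all_classical all_reals all_analysis.
From mathcomp Require Import complex ring lra.
Import Order.TTheory GRing.Theory Num.Theory.
Import numFieldNormedType.Exports.
Set Implicit Arguments.
Unset Strict Implicit.
Unset Printing Implicit Defensive.
Local Open Scope classical_set_scope.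
Local Open Scope ring_scope.
Local Open Scope complex_scope.
Import ComplexField.Normc.

(** * Unordered sums *)

Section UnorderedSums.
Context {R : realType}.

(** The family [gegenbauer] is known only through its generating function, so it has to be shown
    that such a family exists and that its values satisfy |C_n(t)| <= C_n(1). Both facts go through
    the three-term recurrence. Its solutions obey the differential equation of (1 - 2 t h +
    h^2)^-nu, but to sum their series on all of |h| < 1 the bound is needed beforehand. It is
    therefore derived from the recurrence alone, by a real form of the factorisation of 1 - 2 t h +
    h^2 as (1 - w h) times its conjugate, with |w| = 1. Uniqueness of power series coefficients then
    carries the bound over to the chosen family. Unordered sums are defined through positive and
    negative parts, so linearity and Fubini are first established for real families; complex sums
    are handled by their real and imaginary parts. *)

Definition abs_summ (I : choiceType) (u : I -> R) : Prop :=
  summable [set: I] (fun k => (u k)%:E).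

Section OneIndex.
Context {I : choiceType}.
Implicit Types u v : I -> R.

Lemma abs_summ_le u v :
  (forall k, `|u k| <= `|v k|) -> abs_summ v -> abs_summ u.
Proof.
move=> uv; apply: le_lt_trans; apply: le_esum => k _.
by rewrite lee_fin.
Qed.

Lemma abs_summ_norm u : abs_summ u -> abs_summ (fun k => `|u k|).
Proof. by apply: abs_summ_le => k; rewrite normr_id. Qed.

Lemma abs_summD u v : abs_summ u -> abs_summ v -> abs_summ (fun k => u k + v k).
Proof.
move=> su sv.
rewrite /abs_summ (_ : (fun k => _) = (fun k => (u k)%:E) \+ (fun k => (v k)%:E))%E //.
exact: summableD.
Qed.

Lemma abs_summ_esum u : (forall k, 0 <= u k) -> abs_summ u ->
  (\esum_(k in [set: I]) (u k)%:E = (fine (\esum_(k in [set: I]) (u k)%:E))%:E)%E.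
Proof.
move=> u0 su; rewrite fineK// ge0_fin_numE ?esum_ge0//.
  by apply: le_lt_trans su; apply: le_esum => k _; rewrite lee_fin ler_norm.
by move=> k _; rewrite lee_fin.
Qed.

(** The sum does not depend on how a family is split into a difference of nonnegative summable ones:
    if p and q are the positive and negative parts of u - v, then p + v = q + u, and sums of
    nonnegative families are additive. Linearity for signed families rests on this. *)
Lemma rsum_sub u v : (forall k, 0 <= u k) -> (forall k, 0 <= v k) ->
  abs_summ u -> abs_summ v ->
  rsum (fun k => u k - v k) =
  fine (\esum_(k in [set: I]) (u k)%:E)%E - fine (\esum_(k in [set: I]) (v k)%:E)%E.
Proof.
move=> u0 v0 su sv; rewrite /rsum.
set p := fun k => Num.max (u k - v k) 0.
set q := fun k => Num.max (- (u k - v k)) 0.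
have suv : abs_summ (fun k => u k + v k) by exact: abs_summD.
have p0 k : 0 <= p k by rewrite /p le_max lexx orbT.
have q0 k : 0 <= q k by rewrite /q le_max lexx orbT.
have sp : abs_summ p.
  apply: abs_summ_le suv => k; rewrite !ger0_norm ?addr_ge0//.
  by rewrite /p ge_max addr_ge0// andbT lerD2l (le_trans _ (v0 k))// oppr_le0.
have sq : abs_summ q.
  apply: abs_summ_le suv => k; rewrite !ger0_norm ?addr_ge0//.
  by rewrite /q ge_max addr_ge0// andbT opprB addrC lerD2r (le_trans _ (u0 k))// oppr_le0.
have : (\esum_(k in [set: I]) (p k + v k)%:E = \esum_(k in [set: I]) (q k + u k)%:E)%E.
  apply: eq_esum => k _; congr EFin; rewrite /p /q.
  by case: (leP 0 (u k - v k)) => h; case: (leP 0 (- (u k - v k))) => h'; lra.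
under eq_esum do rewrite EFinD.
under [RHS]eq_esum do rewrite EFinD.
rewrite !esumD; do ?by move=> *; rewrite lee_fin.
rewrite (abs_summ_esum p0 sp) (abs_summ_esum q0 sq) (abs_summ_esum u0 su).
rewrite (abs_summ_esum v0 sv) -!EFinD /= => -[]; rewrite /p /q; lra.
Qed.

Lemma eq_rsum u v : u =1 v -> rsum u = rsum v.
Proof. by move=> /funext->. Qed.

Lemma rsum_ge0E u : (forall k, 0 <= u k) ->
  rsum u = fine (\esum_(k in [set: I]) (u k)%:E)%E.
Proof.
move=> u0; rewrite /rsum [X in _ - fine X]esum1 /= ?subr0; last first.
  by move=> k _; congr EFin; apply/max_idPr; rewrite oppr_le0.
by congr fine; apply: eq_esum => k _; congr EFin; apply/max_idPl.
Qed.

Lemma abs_summ_rsumE u : (forall k, 0 <= u k) -> abs_summ u ->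
  (\esum_(k in [set: I]) (u k)%:E = (rsum u)%:E)%E.
Proof. by move=> u0 su; rewrite abs_summ_esum// rsum_ge0E. Qed.

Lemma rsum_ge0 u : (forall k, 0 <= u k) -> 0 <= rsum u.
Proof. by move=> u0; rewrite rsum_ge0E// fine_ge0// esum_ge0// => k _; rewrite lee_fin. Qed.

Lemma rsum_subE u v : (forall k, 0 <= u k) -> (forall k, 0 <= v k) ->
  abs_summ u -> abs_summ v -> rsum (fun k => u k - v k) = rsum u - rsum v.
Proof. by move=> *; rewrite rsum_sub// !rsum_ge0E. Qed.

Definition rpos u k := Num.max (u k) 0.
Definition rneg u k := Num.max (- u k) 0.

Lemma rpos_ge0 u k : 0 <= rpos u k. Proof. by rewrite le_max lexx orbT. Qed.
Lemma rneg_ge0 u k : 0 <= rneg u k. Proof. by rewrite le_max lexx orbT. Qed.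

Lemma rposneg u k : u k = rpos u k - rneg u k.
Proof.
by rewrite /rpos /rneg; case: (leP (u k) 0); case: (leP (- u k) 0); lra.
Qed.

Lemma rposnegD u k : `|u k| = rpos u k + rneg u k.
Proof.
by rewrite /rpos /rneg; case: (ger0P (u k)); case: (leP (u k) 0); case: (leP (- u k) 0); lra.
Qed.

Lemma abs_summ_rpos u : abs_summ u -> abs_summ (rpos u).
Proof.
apply: abs_summ_le => k; rewrite (rposnegD u k) ger0_norm ?rpos_ge0//.
by rewrite lerDl rneg_ge0.
Qed.

Lemma abs_summ_rneg u : abs_summ u -> abs_summ (rneg u).
Proof.
apply: abs_summ_le => k; rewrite (rposnegD u k) ger0_norm ?rneg_ge0//.
by rewrite lerDr rpos_ge0.
Qed.

Lemma rsum_posneg u : rsum u = rsum (rpos u) - rsum (rneg u).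
Proof.
by rewrite (rsum_ge0E (rpos_ge0 u)) (rsum_ge0E (rneg_ge0 u)).
Qed.

Lemma ge0_rsumD u v : (forall k, 0 <= u k) -> (forall k, 0 <= v k) ->
  abs_summ u -> abs_summ v -> rsum (fun k => u k + v k) = rsum u + rsum v.
Proof.
move=> u0 v0 su sv; have := @rsum_ge0E (fun k => u k + v k).
move=> -> => [|k]; last by rewrite addr_ge0.
under eq_esum do rewrite EFinD.
rewrite esumD; do ?by move=> *; rewrite lee_fin.
by rewrite !abs_summ_rsumE.
Qed.

Lemma rsumD u v : abs_summ u -> abs_summ v ->
  rsum (fun k => u k + v k) = rsum u + rsum v.
Proof.
move=> su sv.
rewrite (@eq_rsum _ (fun k => (rpos u k + rpos v k) - (rneg u k + rneg v k))); last first.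
  by move=> k; rewrite (rposneg u k) (rposneg v k); lra.
have [] := (abs_summ_rpos su, abs_summ_rneg su).
have [] := (abs_summ_rpos sv, abs_summ_rneg sv) => pv nv pu nu.
have p0 := rpos_ge0; have n0 := rneg_ge0.
rewrite rsum_subE; do ?by move=> k; rewrite addr_ge0.
- by rewrite !ge0_rsumD// (rsum_posneg u) (rsum_posneg v); lra.
- exact: abs_summD.
- exact: abs_summD.
Qed.

Lemma rsumN u : rsum (fun k => - u k) = - rsum u.
Proof.
by rewrite /rsum opprB; do 2?congr (_ - _); under eq_esum do rewrite opprK.
Qed.

Lemma abs_summN u : abs_summ u -> abs_summ (fun k => - u k).
Proof. by apply: abs_summ_le => k; rewrite normrN. Qed.

Lemma ge0_esumZ u c : 0 <= c -> (forall k, 0 <= u k) ->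
  (\esum_(k in [set: I]) (c * u k)%:E = c%:E * \esum_(k in [set: I]) (u k)%:E)%E.
Proof.
(* The case c = 0 is apart because the rest divides by c; the sum of u may be infinite. *)
rewrite le_eqVlt => /predU1P[<- u0|c0 u0].
  by rewrite mul0e esum1// => k _; rewrite mul0r.
apply/eqP; rewrite eq_le; apply/andP; split.
  apply: ge_ereal_sup => _ [X [finX _]] <-.
  under eq_fsbigr do rewrite EFinM.
  rewrite -ge0_mule_fsumr; last by move=> k; rewrite lee_fin.
  apply: lee_wpmul2l; first by rewrite lee_fin ltW.
  by apply: ereal_sup_ubound; exists X.
rewrite muleC -lee_pdivlMr//.
apply: ge_ereal_sup => _ [X [finX _]] <-.
rewrite lee_pdivlMr// muleC ge0_mule_fsumr; last by move=> k; rewrite lee_fin.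
by apply: ereal_sup_ubound; exists X.
Qed.

Lemma abs_summZ u c : abs_summ u -> abs_summ (fun k => c * u k).
Proof.
move=> su; rewrite /abs_summ /summable.
under eq_esum do rewrite abse_EFin normrM.
rewrite ge0_esumZ//.
have -> := abs_summ_rsumE (fun k => normr_ge0 (u k)) (abs_summ_norm su).
by rewrite -EFinM ltry.
Qed.

Lemma rsumZ u c : abs_summ u -> rsum (fun k => c * u k) = c * rsum u.
Proof.
have pos v (d : R) : abs_summ v -> 0 <= d -> rsum (fun k => d * v k) = d * rsum v.
  move=> sv d0; rewrite (@eq_rsum _ (fun k => d * rpos v k - d * rneg v k)); last first.
    by move=> k; rewrite (rposneg v k) mulrBr.
  rewrite rsum_subE.
  - rewrite [in RHS]rsum_posneg mulrBr.
    rewrite !rsum_ge0E; do ?by move=> k; rewrite ?mulr_ge0 ?rpos_ge0 ?rneg_ge0.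
    rewrite !ge0_esumZ//; do ?by move=> k; rewrite ?rpos_ge0 ?rneg_ge0.
    have -> := abs_summ_rsumE (rpos_ge0 v) (abs_summ_rpos sv).
    by have -> := abs_summ_rsumE (rneg_ge0 v) (abs_summ_rneg sv).
  - by move=> k; rewrite mulr_ge0// rpos_ge0.
  - by move=> k; rewrite mulr_ge0// rneg_ge0.
  - exact/abs_summZ/abs_summ_rpos.
  - exact/abs_summZ/abs_summ_rneg.
move=> su; have [c0|c0] := leP 0 c; first exact: pos.
rewrite (@eq_rsum _ (fun k => - (- c * u k))); last by move=> k; rewrite mulNr opprK.
by rewrite rsumN pos// ?oppr_ge0 ?ltW// mulNr opprK.
Qed.

Lemma rsumB u v : abs_summ u -> abs_summ v ->
  rsum (fun k => u k - v k) = rsum u - rsum v.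
Proof. by move=> su sv; rewrite rsumD ?rsumN//; exact: abs_summN. Qed.

Lemma abs_summB u v : abs_summ u -> abs_summ v -> abs_summ (fun k => u k - v k).
Proof. by move=> su sv; apply: abs_summD => //; exact: abs_summN. Qed.

Lemma ge0_le_rsum u v : (forall k, 0 <= u k <= v k) -> abs_summ v ->
  rsum u <= rsum v.
Proof.
move=> uv sv.
have u0 k : 0 <= u k by case/andP: (uv k).
have v0 k : 0 <= v k by case/andP: (uv k) => /le_trans; apply.
have su : abs_summ u.
  by apply: abs_summ_le sv => k; rewrite !ger0_norm//; case/andP: (uv k).
rewrite -lee_fin -!abs_summ_rsumE//; apply: le_esum => k _.
by rewrite lee_fin; case/andP: (uv k).
Qed.

Lemma ler_norm_rsum u : abs_summ u -> `|rsum u| <= rsum (fun k => `|u k|).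
Proof.
move=> su; rewrite (eq_rsum (rposnegD u)) ge0_rsumD; last 4 first.
- exact: rpos_ge0.
- exact: rneg_ge0.
- exact: abs_summ_rpos.
- exact: abs_summ_rneg.
rewrite rsum_posneg (le_trans (ler_normB _ _))// !ger0_norm ?rsum_ge0//.
  exact: rneg_ge0.
exact: rpos_ge0.
Qed.

Lemma ler_norm_rsum_le u v : (forall k, `|u k| <= v k) -> abs_summ v ->
  `|rsum u| <= rsum v.
Proof.
move=> uv sv; apply: (@le_trans _ _ (rsum (fun k => `|u k|))).
  apply: ler_norm_rsum; apply: abs_summ_le sv => k.
  by rewrite (le_trans (uv k))// ler_norm.
by apply: ge0_le_rsum => // k; rewrite normr_ge0 uv.
Qed.

Lemma ge0_rsum_single u k0 : (forall k, k != k0 -> u k = 0) -> 0 <= u k0 ->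
  rsum u = u k0.
Proof.
move=> uk u0; have u0' k : 0 <= u k by have [->//|/uk->] := eqVneq k k0.
rewrite rsum_ge0E// (esumID [set k0]) ?setTI; last by move=> k _; rewrite lee_fin.
rewrite esum_set1 ?lee_fin// esum1 ?adde0//.
by move=> k kk0; rewrite uk//; exact/eqP.
Qed.

Lemma rsum_single u k0 : (forall k, k != k0 -> u k = 0) -> rsum u = u k0.
Proof.
move=> uk; have [u0|u0] := leP 0 (u k0); first exact: ge0_rsum_single.
have := @ge0_rsum_single (fun k => - u k) k0.
rewrite rsumN => h; apply: oppr_inj; apply: h; last by rewrite oppr_ge0 ltW.
by move=> k /uk ->; rewrite oppr0.
Qed.

End OneIndex.

Lemma abs_summ_bij (I J : choiceType) (e : J -> I) (u : I -> R) :
  bijective e -> abs_summ u -> abs_summ (u \o e).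
Proof.
rewrite -setTT_bijective => be; rewrite /abs_summ /summable.
by rewrite -(reindex_esum setT setT e (fun k => `|(u k)%:E|%E)).
Qed.

Lemma rsum_bij (I J : choiceType) (e : J -> I) (u : I -> R) :
  bijective e -> rsum u = rsum (u \o e).
Proof.
rewrite -setTT_bijective => be; rewrite /rsum.
rewrite (reindex_esum setT setT e)//.
by rewrite (reindex_esum setT setT e).
Qed.

(** * Tonelli and Fubini for families indexed by a product *)

Section TwoIndices.
Context {I J : choiceType}.
Implicit Types u : I * J -> R.

Lemma ge0_esum_pair u : (forall k, 0 <= u k) ->
  (\esum_(k in [set: I * J]) (u k)%:E =
   \esum_(i in [set: I]) \esum_(j in [set: J]) (u (i, j))%:E)%E.
Proof.
move=> u0; rewrite (@esum_esum _ _ _ [set: I] (fun=> setT) (fun i j => (u (i, j))%:E)); last first.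
  by move=> *; rewrite lee_fin.
have -> : [set: I] `*`` (fun=> [set: J]) = setT by apply/seteqP; split.
by apply: eq_esum => -[].
Qed.

Lemma abs_summ_pairP u :
  (forall i, abs_summ (fun j => u (i, j))) ->
  abs_summ (fun i => rsum (fun j => `|u (i, j)|)) -> abs_summ u.
Proof.
move=> su ssu; rewrite /abs_summ /summable.
rewrite (eq_esum (b := fun k => `|u k|%:E))//.
rewrite ge0_esum_pair//; apply: le_lt_trans ssu.
apply: le_esum => i _; rewrite abse_EFin ger0_norm; last exact: rsum_ge0.
by rewrite -abs_summ_rsumE//; exact: abs_summ_norm.
Qed.

Lemma abs_summ_pair1 u i : abs_summ u -> abs_summ (fun j => u (i, j)).
Proof.
rewrite /abs_summ /summable (eq_esum (b := fun k => `|u k|%:E))//.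
rewrite ge0_esum_pair//; apply: le_lt_trans.
rewrite [leRHS](esumID [set i]) ?setTI; last by move=> *; rewrite esum_ge0.
rewrite esum_set1 ?esum_ge0// leeDl// esum_ge0// => *; exact: esum_ge0.
Qed.

Lemma abs_summ_pair2 u : abs_summ u ->
  abs_summ (fun i => rsum (fun j => `|u (i, j)|)).
Proof.
move=> su; have := su; rewrite {1}/abs_summ {1}/summable.
rewrite (eq_esum (b := fun k => `|u k|%:E))//.
rewrite ge0_esum_pair//; apply: le_lt_trans.
apply: le_esum => i _; rewrite abse_EFin ger0_norm; last exact: rsum_ge0.
by rewrite -abs_summ_rsumE//; apply: abs_summ_norm; exact: abs_summ_pair1.
Qed.

Lemma ge0_rsum_pair u : (forall k, 0 <= u k) -> abs_summ u ->
  rsum u = rsum (fun i => rsum (fun j => u (i, j))).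
Proof.
move=> u0 su; rewrite !rsum_ge0E//; last by move=> i; apply: rsum_ge0.
rewrite ge0_esum_pair//; congr fine; apply: eq_esum => i _.
by rewrite abs_summ_rsumE//; exact: abs_summ_pair1.
Qed.

Lemma rsum_pair u : abs_summ u ->
  rsum u = rsum (fun i => rsum (fun j => u (i, j))).
Proof.
move=> su; rewrite rsum_posneg.
have sp := abs_summ_rpos su; have sn := abs_summ_rneg su.
rewrite (ge0_rsum_pair (rpos_ge0 u) sp) (ge0_rsum_pair (rneg_ge0 u) sn).
rewrite -rsumB.
- apply: eq_rsum => i; rewrite -rsumB.
  + by apply: eq_rsum => j; rewrite -rposneg.
  + exact: abs_summ_pair1.
  + exact: abs_summ_pair1.
- apply: abs_summ_le (abs_summ_pair2 sp) => i.
  by under [in leRHS]eq_rsum do rewrite ger0_norm ?rpos_ge0//.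
- apply: abs_summ_le (abs_summ_pair2 sn) => i.
  by under [in leRHS]eq_rsum do rewrite ger0_norm ?rneg_ge0//.
Qed.

End TwoIndices.

Section NatIndex.
Implicit Types u : nat -> R.

(** The entry point from ordered to unordered sums: summability is read off from a limit of partial
    sums, which is how the Gegenbauer and exponential series come in. *)
Lemma ge0_series_cvg u (l : R) : (forall k, 0 <= u k) -> series u @ \oo --> l ->
  abs_summ u /\ rsum u = l.
Proof.
move=> u0 ul.
have E : (\esum_(k in [set: nat]) (u k)%:E = l%:E)%E.
  rewrite -nneseries_esumT//.
  apply/cvg_lim => //.
  rewrite (_ : (fun n => _) = EFin \o series u).
    by apply: cvg_comp ul _.
  by apply/funext => n; rewrite /= /series /= sumEFin.
split; last by rewrite rsum_ge0E// E.
rewrite /abs_summ /summable (eq_esum (b := fun k => (u k)%:E)) ?E ?ltry//.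
by move=> k _; rewrite abse_EFin ger0_norm.
Qed.

Lemma rsum_series_cvg u : abs_summ u -> series u @ \oo --> rsum u.
Proof.
have pos v : abs_summ v -> (forall k, 0 <= v k) -> series v @ \oo --> rsum v.
  move=> sv v0; have : cvgn (series v).
    have := @summable_cvg _ predT (fun k => (v k)%:E).
    by apply=> [k _|]; [rewrite lee_fin|move: sv; rewrite /abs_summ -set_true].
  by move=> cv; have [_ ->] := ge0_series_cvg v0 cv.
move=> su; rewrite rsum_posneg.
have -> : series u = series (rpos u) \- series (rneg u).
  apply/funext => n; rewrite /series /= -sumrB; apply: eq_bigr => k _.
  exact: rposneg.
apply: cvgB; apply: pos.
- exact: abs_summ_rpos.
- exact: rpos_ge0.
- exact: abs_summ_rneg.
- exact: rneg_ge0.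
Qed.

End NatIndex.

End UnorderedSums.

(** * Gegenbauer polynomials *)

Section PowerSeries.
Context {R : realType}.
Implicit Types c : nat -> R.

(** Abel's lemma: comparison with the geometric series of ratio |h| / q. *)
Lemma cvgn_pseries_bounded c (q M h : R) :
  (forall k, `|c k| * q ^+ k <= M) -> `|h| < q -> cvgn (pseries c h).
Proof.
move=> cM hq; have q0 : 0 < q by exact: le_lt_trans hq.
apply: normed_cvg.
apply: (@series_le_cvg _ _ (geometric M (`|h| / q))) => [k|k|k|] //=.
- apply: mulr_ge0; first by rewrite (le_trans _ (cM 0%N))// mulr_ge0.
  by rewrite exprn_ge0// divr_ge0// ltW.
- rewrite normrM normrX expr_div_n mulrA ler_pdivlMr ?exprn_gt0//.
  by rewrite mulrAC ler_wpM2r ?exprn_ge0.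
- apply: is_cvg_geometric_series.
  by rewrite ger0_norm ?divr_ge0 ?(ltW q0)// ltr_pdivrMr// mul1r.
Qed.

(** The factor k + 1 is absorbed by shrinking the radius to some r with |h| < r < q: Bernoulli's
    inequality for (q / r)^(k + 1) gives (k + 1) r^k (q - r) <= q^(k + 1), and the terms of the
    series at q are bounded. *)
Lemma cvgn_pseries_diffs c (h q : R) : `|h| < q -> cvgn (pseries c q) ->
  cvgn (pseries (pseries_diffs c) h).
Proof.
move=> hq cq; have [M [Mreal HM]] := cvg_series_bounded cq.
have [r [hr rq]] : exists r : R, `|h| < r /\ r < q.
  by exists ((`|h| + q) / 2); split; lra.
have r0 : 0 < r by exact: le_lt_trans hr.
have q0 : 0 < q by exact: lt_trans rq.
have d0 : 0 < q / r - 1 by rewrite subr_gt0 ltr_pdivlMr// mul1r.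
apply: (@cvgn_pseries_bounded _ r ((`|M| + 1) / (q - r))) => // k.
have : `|c k.+1 * q ^+ k.+1| <= `|M| + 1.
  by apply: HM => //; rewrite ltr_pwDr// ler_norm.
rewrite normrM normrX (ger0_norm (ltW q0)) => Hk.
rewrite ler_pdivlMr ?subr_gt0// (le_trans _ Hk)//.
rewrite /pseries_diffs normrM normr_nat.
rewrite [leLHS](_ : _ = `|c k.+1| * (k.+1%:R * (q / r - 1) * r ^+ k.+1)); last first.
  by rewrite exprS; field; rewrite gt_eqF.
rewrite ler_wpM2l//.
have {2}-> : q = (1 + (q / r - 1)) * r by field; rewrite gt_eqF.
rewrite exprMn; apply: ler_wpM2r; first by rewrite exprn_ge0 ?(ltW r0).
elim: k.+1 => [|j IH]; first by rewrite expr0 mul0r.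
rewrite exprS mulrDl mul1r mulrSr mulrDl mul1r lerD//.
by rewrite ler_peMr ?(ltW d0)// exprn_ege1// lerDl ltW.
Qed.

Lemma is_derive_pseries c (h q : R) : `|h| < q ->
  (forall x, `|x| < q -> cvgn (pseries c x)) ->
  is_derive h (1 : R) (fun x => limn (pseries c x))
    (limn (pseries (pseries_diffs c) h)).
Proof.
move=> hq cc.
have h0 := normr_ge0 h.
(* [pseries_snd_diffs] asks for convergence of the series and of its first two formal derivatives at
   a point a beyond |h|; each formal derivative costs a strictly larger radius. *)
have [a [b [d [ha ab bd dq]]]] : exists a b d : R,
    [/\ `|h| < a, a < b, b < d & d < q].
  exists ((`|h| *+ 3 + q) / 4), ((`|h| *+ 2 + q *+ 2) / 4), ((`|h| + q *+ 3) / 4).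
  by split; lra.
have na : `|a| = a by rewrite ger0_norm//; lra.
have nb : `|b| = b by rewrite ger0_norm//; lra.
have nd : `|d| = d by rewrite ger0_norm//; lra.
apply: (@pseries_snd_diffs _ c a).
- by apply: cc; rewrite na; lra.
- by apply: (@cvgn_pseries_diffs _ _ b); rewrite ?na//; apply: cc; rewrite nb; lra.
- apply: (@cvgn_pseries_diffs _ _ b); rewrite ?na//.
  by apply: (@cvgn_pseries_diffs _ _ d); rewrite ?nb//; apply: cc; rewrite nd.
- by rewrite na.
Qed.

Lemma pseries0 c : limn (pseries c 0) = c 0%N.
Proof.
apply: (@cvg_lim _) => //; rewrite -cvg_shiftS /=.
apply: cvg_near_cst; apply: nearW => n; rewrite /pseries /series /= big_nat_recl//=.
by rewrite expr0 mulr1 big1 ?addr0// => i _; rewrite exprS mul0r mulr0.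
Qed.

(** Induction on k for all c at once: evaluation at 0 kills c_0, and the formal derivative, with
    coefficients (k + 1) c_(k+1), sums to the derivative of the zero function. *)
Lemma pseries_eq0 c (q : R) : 0 < q ->
  (forall h, `|h| < q -> pseries c h @ \oo --> (0 : R)) -> forall k, c k = 0.
Proof.
move=> q0 + k; elim: k c => [|k IH] c c0.
  have h0 : `|0 : R| < q by rewrite normr0.
  by rewrite -(pseries0 c); apply: (cvg_lim _ (c0 _ h0)).
suff /IH : forall h, `|h| < q -> pseries (pseries_diffs c) h @ \oo --> (0 : R).
  by move/eqP; rewrite mulf_eq0 pnatr_eq0 /= => /eqP.
move=> h hq.
have cc x : `|x| < q -> cvgn (pseries c x) by move=> /c0 cx; apply/cvg_ex; exists (0 : R).
have dc : cvgn (pseries (pseries_diffs c) h).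
  have [r [hr rq]] : exists r : R, `|h| < r /\ r < q.
    by exists ((`|h| + q) / 2); split; lra.
  apply: (cvgn_pseries_diffs hr); apply: cc; rewrite ger0_norm//.
  by rewrite (le_trans _ (ltW hr)).
have D := is_derive_pseries hq cc.
suff <- : limn (pseries (pseries_diffs c) h) = 0 by [].
rewrite -(@derive_val _ _ _ _ _ _ _ D).
have D0 : is_derive h (1 : R) (cst (0 : R)) 0 by exact: is_derive_cst.
rewrite -[RHS](@derive_val _ _ _ _ _ _ _ D0).
apply: near_eq_derive => /=.
near=> x; apply: (cvg_lim _ (c0 x _)) => //; near: x.
exact: (@cvgr_norm_lt _ _ _ (nbhs h) _ id h (@cvg_id _ _) q hq).
Unshelve. all: by end_near. Qed.

Lemma series_cvg_shift (u : nat -> R) (a l : R) : series u @ \oo --> l ->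
  series (fun k => if k is j.+1 then a * u j else 0) @ \oo --> a * l.
Proof.
move=> ul; rewrite -cvg_shiftS.
rewrite (_ : (fun n => _) = (fun n => a * series u n)); first exact: cvgMr.
apply/funext => n; rewrite /series /= big_nat_recl//= add0r.
by rewrite big_distrr.
Qed.

Lemma is_derive_0_ball_cst (f : R -> R) (q h : R) : `|h| < q ->
  (forall x : R, `|x| < q -> is_derive x (1 : R) f 0) -> f h = f 0.
Proof.
move=> hq df.
have cont (a b : R) : - q < a -> b < q -> {within `[a, b], continuous f}.
  move=> qa bq; apply: derivable_within_continuous => x; rewrite in_itv /= => /andP[ax xb].
  by have [] : is_derive x (1 : R) f 0 by apply: df; rewrite ltr_norml; lra.
have [h0|h0] := leP 0 h.
- have [||c _] := @MVT_segment _ f (cst 0) 0 h h0.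
  + move=> x; rewrite in_itv /= => /andP[x0 xh]; apply: df.
    by rewrite ltr_norml; move: hq; rewrite ltr_norml; lra.
  + by apply: cont; move: hq; rewrite ltr_norml; lra.
  + by rewrite mul0r; lra.
- have [||c _] := @MVT_segment _ f (cst 0) h 0 (ltW h0).
  + move=> x; rewrite in_itv /= => /andP[x0 xh]; apply: df.
    by rewrite ltr_norml; move: hq; rewrite ltr_norml; lra.
  + by apply: cont; move: hq; rewrite ltr_norml; lra.
  + by rewrite mul0r; lra.
Qed.

End PowerSeries.

(** * Gegenbauer polynomials through their three-term recurrence *)

Section Gegenbauer.
Context {R : realType}.
Implicit Types (nu t : R) (c : nat -> R).

(** Coefficientwise form of (1 - 2 t x + x^2) f' = 2 nu (t - x) f, f(0) = 1, whose solution is f(x)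
    = (1 - 2 t x + x^2)^-nu. *)
Definition geg_rec nu t c :=
  [/\ c 0%N = 1, c 1%N = 2 * nu * t &
      forall k, k.+2%:R * c k.+2 =
        2 * (nu + k.+1%:R) * t * c k.+1 - (2 * nu + k%:R) * c k].

Fixpoint geg_pair nu k : {poly R} * {poly R} :=
  if k is j.+1 then
    let p := geg_pair nu j in
    (p.2, j.+2%:R^-1 *: ((2 * (nu + j.+1%:R)) *: 'X * p.2 - (2 * nu + j%:R) *: p.1))
  else (1, (2 * nu) *: 'X).

Definition geg_poly nu k := (geg_pair nu k).1.

Lemma geg_poly_rec nu t : geg_rec nu t (fun k => (geg_poly nu k).[t]).
Proof.
split=> [||k]; rewrite /geg_poly /= ?hornerE//.
by rewrite /= divff ?pnatr_eq0// mul1r.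
Qed.

(** This is C^nu_k(1), the coefficient of h^k in (1 - h)^(-2 nu). *)
Definition geg_bound nu k : R := \prod_(i < k) ((2 * nu + i%:R) / i.+1%:R).

Lemma geg_boundS nu k :
  k.+1%:R * geg_bound nu k.+1 = (2 * nu + k%:R) * geg_bound nu k.
Proof.
by rewrite /geg_bound big_ord_recr /= mulrC mulrA; field; rewrite -mulrS pnatr_eq0.
Qed.

Lemma geg_bound_gt0 nu k : 0 < nu -> 0 < geg_bound nu k.
Proof.
move=> nu0; apply: prodr_gt0 => i _; rewrite divr_gt0//.
by rewrite ltr_wpDr// mulr_gt0.
Qed.

(** Places the bound among the solutions of the recurrence, at t = 1, so that [geg_rec_sum] computes
    its sum as well. *)
Lemma geg_bound_rec nu : geg_rec nu 1 (geg_bound nu).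
Proof.
have g0 : geg_bound nu 0 = 1 by rewrite /geg_bound big_ord0.
split=> // [|k].
  by have := geg_boundS nu 0; rewrite g0; lra.
have := geg_boundS nu k; have := geg_boundS nu k.+1.
by rewrite !mulrSr; lra.
Qed.

Lemma cvgn_geg_bound nu (h : R) : 0 < nu -> `|h| < 1 ->
  cvgn (pseries (geg_bound nu) h).
Proof.
move=> nu0 h1.
have [q [hq q1]] : exists q : R, `|h| < q /\ q < 1.
  by exists ((`|h| + 1) / 2); split; lra.
have q0 : 0 < q by exact: le_lt_trans hq.
pose G k := geg_bound nu k * q ^+ k.
have G0 k : 0 <= G k by rewrite mulr_ge0 ?exprn_ge0 ?ltW// geg_bound_gt0.
(* The ratio G (k + 1) / G k is q (2 nu + k) / (k + 1), at most 1 as soon as k (1 - q) >= 2 nu q; so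
   G stays below G N beyond N. *)
pose N := Num.bound (2 * nu * q / (1 - q)).
have GN k : G (N + k)%N <= G N.
  elim: k => [|k IH]; first by rewrite addn0.
  apply: le_trans IH; rewrite addnS /G exprSr mulrA mulrAC.
  apply: ler_wpM2r; first by rewrite exprn_ge0 ?ltW.
  rewrite -(@ler_pM2l _ (N + k).+1%:R) ?ltr0n// mulrA geg_boundS mulrAC.
  apply: ler_wpM2r; first by rewrite ltW// geg_bound_gt0.
  have : 2 * nu * q / (1 - q) < N%:R.
    by apply: archi_boundP; rewrite divr_ge0 ?subr_ge0 ?mulr_ge0 ?ltW.
  rewrite ltr_pdivrMr ?subr_gt0// => HN.
  rewrite mulrSr natrD; have : 0 <= k%:R :> R by [].
  nra.
apply: (@cvgn_pseries_bounded _ _ q (\sum_(i < N.+1) G i)) => // k.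
rewrite ger0_norm; last exact/ltW/geg_bound_gt0.
rewrite -/(G k).
have [kN|Nk] := leqP k N.
  by rewrite (bigD1 (Ordinal (kN : k < N.+1)%N))//= lerDl sumr_ge0.
rewrite -(subnKC (ltnW Nk)) (le_trans (GN _))//.
by rewrite big_ord_recr /= lerDr sumr_ge0.
Qed.

(** If F is the generating function of c, that of z is Z = nu w h F / (1 - w h). When F is ((1 - w
    h)(1 - w' h))^-nu, with w' conjugate to w, its logarithmic derivative gives h F' = Z + Z', with
    Z' conjugate to Z; this is where k c_k = 2 Re z_k comes from. *)
Fixpoint rot_seq nu t s c k : R * R :=
  if k is j.+1 then
    let p := rot_seq nu t s c j in
    (t * (nu * c j + p.1) - s * p.2, s * (nu * c j + p.1) + t * p.2)
  else (0, 0).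

(* With w = t + i s on the unit circle, z_0 = 0 and z_(k+1) = w (nu c_k + z_k),
   one has k c_k = 2 Re z_k, and |z_k| is controlled since |w| = 1. *)
Lemma geg_rec_bound nu t c : 0 < nu -> `|t| <= 1 -> geg_rec nu t c ->
  forall k, `|c k| <= geg_bound nu k.
Proof.
move=> nu0 t1 [c0 c1 cS].
pose s := Num.sqrt (1 - t ^+ 2).
have s2 : s ^+ 2 = 1 - t ^+ 2.
  by rewrite sqr_sqrtr//; move: t1; rewrite ler_norml => /andP[]; nra.
set z := rot_seq nu t s c.
have Re_z k : k%:R * c k = 2 * (z k).1 /\ k.+1%:R * c k.+1 = 2 * (z k.+1).1.
  elim: k => [|k [IH0 IH1]].
    by rewrite /z /= c0 c1; split; ring.
  split=> //; rewrite cS.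
  have E1 : (z k.+1).1 = t * (nu * c k + (z k).1) - s * (z k).2 by [].
  have E2 : (z k.+1).2 = s * (nu * c k + (z k).1) + t * (z k).2 by [].
  have -> : (z k.+2).1 = t * (nu * c k.+1 + (z k.+1).1) - s * (z k.+1).2 by [].
  (* Real part of w' z_(k+1) = nu c_k + z_k, w' being the conjugate and inverse of w; it eliminates
     the imaginary part from Re z_(k+2). *)
  have -> : s * (z k.+1).2 = nu * c k + (z k).1 - t * (z k.+1).1.
    by rewrite E1 E2; ring: s2.
  move: IH0 IH1; rewrite [k.+1%:R]mulrSr; nra.
(* With g the bound, the induction carries 2 |z_k| <= k g_k, squared. As |w| = 1, 2 |z_(k+1)| = 2
   |nu c_k + z_k| <= (2 nu + k) g_k = (k + 1) g_(k+1), and (k + 1) |c_(k+1)| = 2 |Re z_(k+1)|. In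
   the expanded square the cross term is a multiple of c_k^2 because 2 Re z_k = k c_k. *)
have bound k : `|c k| <= geg_bound nu k /\
    4 * ((z k).1 ^+ 2 + (z k).2 ^+ 2) <= (k%:R * geg_bound nu k) ^+ 2.
  elim: k => [|k [IH0 IH1]].
    by rewrite /geg_bound big_ord0 c0 normr1 /= mul0r !expr0n /= addr0 mulr0.
  have Z : 4 * ((z k.+1).1 ^+ 2 + (z k.+1).2 ^+ 2) <=
           (k.+1%:R * geg_bound nu k.+1) ^+ 2.
    rewrite geg_boundS /=.
    set g := geg_bound nu k in IH0 IH1 *.
    have -> : 4 * ((t * (nu * c k + (z k).1) - s * (z k).2) ^+ 2 +
                   (s * (nu * c k + (z k).1) + t * (z k).2) ^+ 2) =
              4 * (nu * c k) ^+ 2 + 4 * nu * c k * (2 * (z k).1) +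
              4 * ((z k).1 ^+ 2 + (z k).2 ^+ 2) by ring: s2.
    have [<- _] := Re_z k.
    have c2 : c k ^+ 2 <= g ^+ 2.
      by rewrite -[leLHS]real_normK ?num_real// lerXn2r ?nnegrE// (le_trans _ IH0).
    have k0 : 0 <= k%:R :> R by [].
    have -> : ((2 * nu + k%:R) * g) ^+ 2 = 4 * nu ^+ 2 * g ^+ 2 +
      4 * nu * k%:R * g ^+ 2 + (k%:R * g) ^+ 2 by ring.
    have -> : 4 * (nu * c k) ^+ 2 + 4 * nu * c k * (k%:R * c k) =
      4 * nu ^+ 2 * c k ^+ 2 + 4 * nu * k%:R * c k ^+ 2 by ring.
    rewrite lerD// lerD// ler_wpM2l ?mulr_ge0 ?exprn_ge0 ?(ltW nu0)//.
  split=> //.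
  have g0 : 0 <= k.+1%:R * geg_bound nu k.+1 by rewrite mulr_ge0// ltW// geg_bound_gt0.
  rewrite -(@ler_pM2l _ k.+1%:R) ?ltr0n//.
  rewrite -[X in X * _]normr_nat -normrM.
  rewrite -(@ler_pXn2r _ 2)// ?nnegrE//.
  rewrite real_normK ?num_real//; apply: le_trans Z.
  have [_ ->] := Re_z k; rewrite exprMn mulrDr.
  have -> : (2 : R) ^+ 2 = 4 by ring.
  by rewrite lerDl mulr_ge0// sqr_ge0.
by move=> k; case: (bound k).
Qed.

(** The quantity is at least (1 - |h|)^2. *)
Lemma geg_denom_gt0 t (h : R) : `|t| <= 1 -> `|h| < 1 -> 0 < 1 - 2 * t * h + h ^+ 2.
Proof.
rewrite ler_norml ltr_norml => /andP[t1 t2] /andP[h1 h2].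
have [h0|h0] := leP 0 h.
  have : 0 < (1 - h) ^+ 2 by rewrite exprn_gt0// subr_gt0.
  nra.
have : 0 < (1 + h) ^+ 2 by rewrite exprn_gt0//; lra.
nra.
Qed.

(* Differential equation of f(x) = (1 - 2 t x + x^2)^-nu. *)
Lemma geg_ode nu t c (x : R) : geg_rec nu t c ->
  cvgn (pseries c x) -> cvgn (pseries (pseries_diffs c) x) ->
  (1 - 2 * t * x + x ^+ 2) * limn (pseries (pseries_diffs c) x) =
  2 * nu * (t - x) * limn (pseries c x).
Proof.
move=> [c0 c1 cS] cF cF1.
set F := limn (pseries c x); set F1 := limn (pseries (pseries_diffs c) x).
pose u k := pseries_diffs c k * x ^+ k.
pose v k := if k is j.+1 then x * u j else 0.
pose w k := if k is j.+1 then x * v j else 0.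
pose p k := if k is j.+1 then x * (c j * x ^+ j) else 0.
have uF : series u @ \oo --> F1 by [].
have vF : series v @ \oo --> x * F1 by exact: series_cvg_shift.
have wF : series w @ \oo --> x * (x * F1) by exact: series_cvg_shift.
have pF : series p @ \oo --> x * F by exact: series_cvg_shift.
have : (fun n => series u n - 2 * t * series v n + series w n -
    2 * nu * t * pseries c x n + 2 * nu * series p n) @ \oo -->
    F1 - 2 * t * (x * F1) + x * (x * F1) - 2 * nu * t * F + 2 * nu * (x * F).
  apply: cvgD; last exact: cvgMr.
  apply: cvgB; last exact: cvgMr.
  apply: cvgD => //; apply: cvgB => //; exact: cvgMr.
rewrite (_ : (fun n => _) = cst 0); last first.
  apply/funext => n; rewrite /pseries /series /= !mulr_sumr -!sumrB -!big_split /=.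
  (* The combination vanishes term by term, hence in every partial sum: term 0 by the initial
     values, the later ones by the recurrence. *)
  rewrite -sumrB -big_split /=; apply: big1 => -[|[|k]] _.
  - by rewrite /p /w /v /= /u /pseries_diffs /= c0 c1; ring.
  - rewrite /p /w /v /= /u /pseries_diffs /= cS c0 c1; ring.
  - rewrite /p /w /v /= /u /pseries_diffs /= cS !exprS -!natr1; ring.
move=> /(cvg_lim _) => /(_ (@Rhausdorff R)).
rewrite (cvg_lim _ (cvg_cst 0))//.
by move=> H; apply/eqP; rewrite -subr_eq0; apply/eqP; rewrite [RHS]H; ring.
Qed.

(** Let F be the sum of the series and d(x) = 1 - 2 t x + x^2. By [geg_ode] the product F d^nu has
    derivative zero on |x| < 1, so it keeps its value c_0 = 1 at the origin. *)
Lemma geg_rec_sum nu t c (h : R) : 0 < nu -> `|t| <= 1 -> geg_rec nu t c ->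
  `|h| < 1 -> pseries c h @ \oo --> ((1 - 2 * t * h + h ^+ 2) `^ nu)^-1.
Proof.
move=> nu0 t1 rc h1.
have cb := geg_rec_bound nu0 t1 rc.
have cc x : `|x| < 1 -> cvgn (pseries c x).
  move=> x1; have [q [hq q1]] : exists q : R, `|x| < q /\ q < 1.
    by exists ((`|x| + 1) / 2); split; lra.
  have q0 : 0 < q by exact: le_lt_trans hq.
  apply: normed_cvg.
  apply: (@series_le_cvg _ _ (fun k => geg_bound nu k * `|x| ^+ k)) => [k|k|k|] //=.
  - by rewrite mulr_ge0 ?exprn_ge0// ltW// geg_bound_gt0.
  - by rewrite normrM normrX ler_wpM2r ?exprn_ge0.
  - by apply: cvgn_geg_bound; rewrite ?normr_id.
have cd x : `|x| < 1 -> cvgn (pseries (pseries_diffs c) x).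
  move=> x1; have [q [hq q1]] : exists q : R, `|x| < q /\ q < 1.
    by exists ((`|x| + 1) / 2); split; lra.
  apply: (cvgn_pseries_diffs hq); apply: cc; rewrite ger0_norm//.
  by rewrite (le_trans _ (ltW hq)).
pose d x : R := 1 - 2 * t * x + x ^+ 2.
have d0 x : `|x| < 1 -> 0 < d x by exact: geg_denom_gt0.
pose G x := limn (pseries c x) * d x `^ nu.
have dG x : `|x| < 1 -> is_derive x (1 : R) G 0.
  move=> x1.
  have dF := is_derive_pseries x1 cc.
  have dd : is_derive x (1 : R) d (2 * x - 2 * t).
    have -> : d = horner (1 - (2 * t) *: 'X + 'X^2).
      by apply/funext => y; rewrite /d !hornerE.
    apply: (is_derive_eq (is_derive_poly _ x)).
    by rewrite !(derivD, derivN, derivZ, derivX, derivXn, derivC) !hornerE /=; ring.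
  have dp := @is_derive1_comp _ (fun y : R => y `^ nu) d x _ _ (is_derive1_powR nu (d0 _ x1)) dd.
  apply: (is_derive_eq (is_deriveM dF dp)); rewrite /GRing.scale /=.
  have -> : d x `^ nu = d x * d x `^ (nu - 1) by rewrite mulr_powRB1// ltW// d0.
  have := geg_ode rc (cc x x1) (cd x x1); rewrite -/(d x).
  set F := limn (pseries c x); set F1 := limn (pseries (pseries_diffs c) x) => E.
  transitivity (d x `^ (nu - 1) * (d x * F1 - 2 * nu * (t - x) * F)); first by ring.
  by rewrite E subrr mulr0.
have := is_derive_0_ball_cst h1 dG.
rewrite /G pseries0 (_ : d 0 = 1); last by rewrite /d; ring.
have [-> _ _] := rc; rewrite powR1 mulr1 => E.
have -> : (d h `^ nu)^-1 = limn (pseries c h).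
  have dn0 : d h `^ nu != 0 by rewrite gt_eqF// powR_gt0// d0.
  by rewrite -[RHS](mulfK dn0) E mul1r.
exact: cc.
Qed.

(** [xget] returns a member of the set once one is exhibited; the polynomials built from the
    recurrence provide it. *)
Lemma gegenbauerP nu : 0 < nu -> is_gegenbauer_family nu (gegenbauer nu).
Proof.
move=> nu0; apply: (@xgetPex _ _ [set C | is_gegenbauer_family nu C]).
exists (geg_poly nu) => t h t1 h1; exact: geg_rec_sum (geg_poly_rec nu t) h1.
Qed.

(** The chosen family need not be [geg_poly] by construction, but at each t in [-1, 1] both have the
    same generating function, so their values there agree. *)
Lemma gegenbauer_bound nu t k : 0 < nu -> `|t| <= 1 ->
  `|(gegenbauer nu k).[t]| <= geg_bound nu k.
Proof.
move=> nu0 t1.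
suff -> : (gegenbauer nu k).[t] = (geg_poly nu k).[t].
  exact: geg_rec_bound (geg_poly_rec nu t) k.
apply/eqP; rewrite -subr_eq0; apply/eqP.
apply: (@pseries_eq0 _ (fun j => (gegenbauer nu j).[t] - (geg_poly nu j).[t]) 1) => //.
move=> h h1.
rewrite -(subrr ((1 - 2 * t * h + h ^+ 2) `^ nu)^-1).
rewrite (_ : pseries _ h = (fun n => series (fun k => (gegenbauer nu k).[t] * h ^+ k) n -
   pseries (fun k => (geg_poly nu k).[t]) h n)); last first.
  apply/funext => n; rewrite /pseries /series /= -sumrB.
  by apply: eq_bigr => i _; rewrite mulrBl.
apply: cvgB; first exact: gegenbauerP.
exact: geg_rec_sum (geg_poly_rec nu t) h1.
Qed.

Lemma geg_bound_sum nu (h : R) : 0 < nu -> 0 <= h < 1 ->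
  pseries (geg_bound nu) h @ \oo --> (((1 - h) ^+ 2) `^ nu)^-1.
Proof.
move=> nu0 /andP[h0 h1].
have -> : (1 - h) ^+ 2 = 1 - 2 * 1 * h + h ^+ 2 by ring.
by apply: (geg_rec_sum nu0 _ (geg_bound_rec nu)); rewrite ?normr1 ?ger0_norm.
Qed.

End Gegenbauer.

(** * Differentiation of multivariate power series *)

Section MultivariatePowerSeries.
Context {R : realType}.

(** Second-order Taylor remainder of the m-th power at x, with increment t. *)
Definition taylor2 (x t : R) m := (x + t) ^+ m - x ^+ m - t * (m%:R * x ^+ m.-1).

Lemma taylor2S x t m :
  taylor2 x t m.+1 = (x + t) * taylor2 x t m + m%:R * t ^+ 2 * x ^+ m.-1.
Proof.
rewrite /taylor2; case: m => [|m]; first by rewrite !expr0 !expr1 /=; ring.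
by rewrite /= !exprS -!natr1; ring.
Qed.

(* Both sides satisfy the recurrence taylor2S, with |x| + d dominating |x + t|. *)
Lemma taylor2_bound (x t d : R) m : `|t| <= d -> 0 < d ->
  `|taylor2 x t m| <= (t / d) ^+ 2 * taylor2 `|x| d m.
Proof.
move=> td d0; elim: m => [|m IH].
  have T0 y s : taylor2 y s 0 = 0 by rewrite /taylor2 !expr0; ring.
  by rewrite !T0 normr0 mulr0.
rewrite !taylor2S (le_trans (ler_normD _ _))// [leRHS]mulrDr lerD//.
  rewrite normrM mulrCA ler_pM//.
  by rewrite (le_trans (ler_normD _ _))// lerD2l.
rewrite mulrAC normrM (ger0_norm (sqr_ge0 t)) normrM normr_nat normrX.
by rewrite le_eqVlt; apply/orP; left; apply/eqP; field; rewrite gt_eqF.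
Qed.

(** The product d m |x|^(m-1) is one term of the binomial expansion of (|x| + d)^m. *)
Lemma deriv_exprn_bound (x d : R) m : 0 < d ->
  `|m%:R * x ^+ m.-1| <= (`|x| + d) ^+ m / d.
Proof.
move=> d0; rewrite normrM normr_nat normrX ler_pdivlMr//.
elim: m => [|m IH]; first by rewrite !mul0r expr0.
rewrite exprS; apply: (@le_trans _ _ (`|x| * (m%:R * `|x| ^+ m.-1 * d) + d * `|x| ^+ m)).
  rewrite /= -natr1 mulrDl mul1r mulrDl lerD//; last by rewrite mulrC.
  case: m {IH} => [|m]; rewrite ?mul0r ?mulr0// exprS le_eqVlt.
  by apply/orP; left; apply/eqP; rewrite /=; ring.
rewrite mulrDl lerD//; first by rewrite ler_wpM2l.
by rewrite ler_wpM2l ?(ltW d0)// lerXn2r ?nnegrE ?addr_ge0 ?(ltW d0)// lerDl ltW.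
Qed.

Context {n : nat}.
Implicit Types (h : 'rV[R]_n) (k : {ffun 'I_n -> nat}) (a : 'I_n -> nat).

(* The a-th derivative of the monomial h^k; when a i > k i the falling factorial
   vanishes, so the truncated exponent is harmless. *)
Definition dmono a h k : R :=
  \prod_i ((k i ^_ a i)%:R * h 0 i ^+ (k i - a i)).

Definition polydisc (r : R) h := forall i, `|h 0 i| < r.

Lemma nbhs_polydisc r h : polydisc r h -> \forall b \near h, polydisc r b.
Proof.
move=> hr.
apply: (@filter_forall _ _ (fun i (b : 'rV[R]_n) => `|b 0 i| < r : Prop) (nbhs h)) => i.
exact: (@cvgr_norm_lt _ _ _ (nbhs h) _ (fun M : 'rV[R]_n => M 0 i) (h 0 i)
  (@coord_continuous R 1 n 0 i h) r (hr i)).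
Qed.

Lemma dmono_shift a h k i (t : R) :
  dmono a (t *: delta_mx 0 i + h) k =
  (\prod_(j | j != i) ((k j ^_ a j)%:R * h 0 j ^+ (k j - a j))) *
  ((k i ^_ a i)%:R * (h 0 i + t) ^+ (k i - a i)).
Proof.
rewrite /dmono (bigD1 i)//= mulrC; congr (_ * _).
  by apply: eq_bigr => j ji; rewrite !mxE eqxx (negbTE ji) mulr0 add0r.
by rewrite !mxE !eqxx mulr1 addrC.
Qed.

Lemma dmono_incr a a' h k i :
  a' i = (a i).+1 -> (forall j, j != i -> a' j = a j) ->
  dmono a' h k =
  (\prod_(j | j != i) ((k j ^_ a j)%:R * h 0 j ^+ (k j - a j))) *
  ((k i ^_ a i)%:R * ((k i - a i)%:R * h 0 i ^+ (k i - a i).-1)).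
Proof.
move=> ai aj; rewrite /dmono (bigD1 i)//= mulrC; congr (_ * _).
  by apply: eq_bigr => j ji; rewrite aj.
by rewrite ai ffactnSr natrM subnS -mulrA.
Qed.

(** * Termwise differentiation in one variable *)

Section Step.
Variables (c : {ffun 'I_n -> nat} -> R) (r : R) (a a' : 'I_n -> nat) (i : 'I_n).
Hypothesis ai : a' i = (a i).+1.
Hypothesis aj : forall j, j != i -> a' j = a j.
Hypothesis sa : forall h, polydisc r h -> abs_summ (fun k => c k * dmono a h k).

(** A point with nonnegative coordinates, still in the polydisc, with room d in the direction i. The
    series there dominates both the derived series and the Taylor remainders at h. *)
Let majorant h (d : R) : 'rV[R]_n := \row_j (`|h 0 j| + (if j == i then d else 0)).

Let polydisc_majorant h (d : R) : polydisc r h -> 0 < d -> `|h 0 i| + d < r ->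
  polydisc r (majorant h d).
Proof.
move=> hr d0 hd j; rewrite mxE; case: eqP => [->|_].
  by rewrite ger0_norm// addr_ge0// ltW.
by rewrite addr0 normr_id.
Qed.

Let dmono_majorant h (d : R) k : 0 < d ->
  dmono a (majorant h d) k =
  `|\prod_(j | j != i) ((k j ^_ a j)%:R * h 0 j ^+ (k j - a j))| *
  ((k i ^_ a i)%:R * (`|h 0 i| + d) ^+ (k i - a i)).
Proof.
move=> d0; rewrite /dmono (bigD1 i)//= mulrC; congr (_ * _); last first.
  by rewrite mxE eqxx.
rewrite normr_prod; apply: eq_bigr => j ji.
by rewrite mxE (negbTE ji) addr0 normrM normr_nat normrX.
Qed.

Let dmono_majorant_ge0 h (d : R) k : 0 < d -> 0 <= dmono a (majorant h d) k.
Proof.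
by move=> d0; rewrite dmono_majorant// !mulr_ge0 ?exprn_ge0// addr_ge0// ltW.
Qed.

Let room h : polydisc r h -> exists2 d : R, 0 < d & `|h 0 i| + d < r.
Proof.
by move=> /(_ i) hr; exists ((r - `|h 0 i|) / 2); lra.
Qed.

Lemma abs_summ_dmono_incr h : polydisc r h -> abs_summ (fun k => c k * dmono a' h k).
Proof.
move=> hr; have [d d0 hd] := room hr.
apply: abs_summ_le (abs_summZ d^-1 (sa (polydisc_majorant hr d0 hd))) => k.
rewrite mulrCA normrM [leRHS]normrM; apply: ler_wpM2l => //.
rewrite [leRHS]ger0_norm; last by rewrite mulr_ge0 ?invr_ge0 ?(ltW d0)// dmono_majorant_ge0.
rewrite (dmono_incr _ _ ai aj) dmono_majorant//.
rewrite normrM [leRHS]mulrCA; apply: ler_wpM2l => //.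
rewrite normrM normr_nat [leRHS]mulrCA; apply: ler_wpM2l => //.
by rewrite (le_trans (deriv_exprn_bound _ _ d0))// mulrC.
Qed.

(** A quadratic estimate replaces uniform convergence: each term has Taylor remainder at most (t /
    d)^2 times the term at the majorant, so the difference quotient is within |t| K of L. *)
Lemma is_derive_rsum_dmono h : polydisc r h ->
  is_derive h (delta_mx 0 i : 'rV[R]_n)
    ((fun b => rsum (fun k => c k * dmono a b k)) : 'rV[R]_n -> R^o)
    (rsum (fun k => c k * dmono a' h k)).
Proof.
move=> hr; have [d d0 hd] := room hr.
set F := (fun b => _); set L := rsum _.
have sM := sa (polydisc_majorant hr d0 hd).
pose K := rsum (fun k => `|c k * dmono a (majorant h d) k|) / d ^+ 2.
have K0 : 0 <= K by rewrite divr_ge0 ?exprn_ge0 ?(ltW d0)// rsum_ge0.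
have main (t : R) : `|t| < d ->
    `|F (t *: delta_mx 0 i + h) - F h - t * L| <= t ^+ 2 * K.
  move=> td.
  have ht : polydisc r (t *: delta_mx 0 i + h).
    move=> j; rewrite !mxE eqxx /=; have [->|ji] := eqVneq j i.
      by rewrite mulr1 (le_lt_trans (ler_normD _ _))//; lra.
    by rewrite mulr0 add0r.
  have s1 := sa ht; have s0 := sa hr; have s' := abs_summ_dmono_incr hr.
  rewrite /F /L -rsumZ// -!rsumB//; last 2 first.
  - exact: abs_summB.
  - exact: abs_summZ.
  rewrite /K mulrCA mulrC -rsumZ; last exact: abs_summ_norm.
  apply: ler_norm_rsum_le; last exact/abs_summZ/abs_summ_norm.
  move=> k.
  (* A shift by 0, so that [dmono_shift] splits off the coordinate i in both monomials. *)
  have -> : dmono a h k = dmono a (0 *: delta_mx 0 i + h) k by rewrite scale0r add0r.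
  rewrite !dmono_shift (dmono_incr _ _ ai aj) addr0.
  set A := \prod_(j | _) _; set b := (k i ^_ a i)%:R; set m := (k i - a i)%N.
  rewrite [X in `|X|](_ : _ = c k * A * b * taylor2 (h 0 i) t m); last first.
    by rewrite /taylor2; ring.
  rewrite !normrM (ger0_norm (dmono_majorant_ge0 _ _ d0)) dmono_majorant//.
  rewrite -/A -/b -/m {1}/b normr_nat -/b.
  rewrite [leRHS](_ : _ = `|c k| * `|A| * b * ((t / d) ^+ 2 * (`|h 0 i| + d) ^+ m)); last first.
    by field; rewrite gt_eqF.
  apply: ler_wpM2l; first by rewrite !mulr_ge0// /b.
  rewrite (le_trans (taylor2_bound _ _ (ltW td) d0))//.
  rewrite ler_wpM2l ?sqr_ge0// /taylor2.
  have : 0 <= `|h 0 i| ^+ m by rewrite exprn_ge0.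
  have : 0 <= d * (m%:R * `|h 0 i| ^+ m.-1).
    by rewrite mulr_ge0 ?(ltW d0)// mulr_ge0// exprn_ge0.
  lra.
have cv : (fun t : R => t^-1 *: (F (t *: delta_mx 0 i + h) - F h)) @ 0^' --> L.
  apply/cvgrPdist_le => e e0; near=> t.
  have t0 : t != 0 by near: t; exact: nbhs_dnbhs_neq.
  have td : `|t| < d.
    near: t; apply: dnbhs0_lt; exact: d0.
  (* K may be 0, hence the denominator K + 1. *)
  have te : `|t| < e / (K + 1).
    by near: t; apply: dnbhs0_lt; rewrite divr_gt0// ltr_wpDl.
  rewrite distrC (_ : _ - L = t^-1 * (F (t *: delta_mx 0 i + h) - F h - t * L)); last first.
    by rewrite /GRing.scale /= [RHS]mulrBr mulKf.
  rewrite normrM normfV mulrC ler_pdivrMr ?normr_gt0//.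
  rewrite (le_trans (main _ td))// -real_normK ?num_real// expr2 mulrC mulrA.
  rewrite ler_wpM2r// mulrC (@le_trans _ _ (`|t| * (K + 1)))//.
    by rewrite ler_wpM2l// lerDl.
  by rewrite -ler_pdivlMr ?ltW// ltr_wpDl.
split; first by apply/cvg_ex; exists L.
exact: cvg_lim.
Unshelve. all: by end_near. Qed.

End Step.

(** The derivative depends on the list only through multiplicities. The induction runs over the
    whole open polydisc, since differentiating once more at h uses the previous derivative near h;
    that one is known as a series only inside the polydisc, hence the equalities near h. *)
Lemma pderivs_rsum (c : {ffun 'I_n -> nat} -> R) (r : R) :
  (forall h, polydisc r h -> abs_summ (fun k => c k * mpow h k)) ->
  forall (l : seq 'I_n) h, polydisc r h ->
  let a i := count_mem i l in
  [/\ abs_summ (fun k => c k * dmono a h k),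
      pderivable (fun b => rsum (fun k => c k * mpow b k)) l h &
      pderivs (fun b => rsum (fun k => c k * mpow b k)) l h =
        rsum (fun k => c k * dmono a h k)].
Proof.
move=> s0; elim=> [|i l IH] h hr a.
  have E b : (fun k => c k * dmono a b k) = (fun k => c k * mpow b k).
    apply/funext => k; congr (_ * _); apply: eq_bigr => j _.
    by rewrite /a /= ffactn0 mul1r subn0.
  by rewrite E; split=> //; exact: s0.
pose a0 j := count_mem j l.
have ai : a i = (a0 i).+1 by rewrite /a /= eqxx.
have aj j : j != i -> a j = a0 j by rewrite /a /= eq_sym => /negbTE ->.
have sa b : polydisc r b -> abs_summ (fun k => c k * dmono a0 b k).
  by move=> /IH[].
have D := is_derive_rsum_dmono ai aj sa hr.
have E : \forall b \near h, rsum (fun k => c k * dmono a0 b k) =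
    pderivs (fun b => rsum (fun k => c k * mpow b k)) l b.
  by apply: filterS (nbhs_polydisc hr) => b /IH[_ _ ->].
split.
- exact: (abs_summ_dmono_incr ai aj sa).
- split.
    by apply: filterS (nbhs_polydisc hr) => b /IH[].
  by apply: near_eq_derivable E _; have [] := D.
- by rewrite /= -(near_eq_derive _ E); have [_ ->] := D.
Qed.

Lemma count_mdirs k i : count_mem i (mdirs k) = k i.
Proof.
rewrite /mdirs count_flatten -map_comp sumnE big_map big_enum /= (bigD1 i)//=.
rewrite count_nseq /= eqxx mul1n big1 ?addn0// => j ji.
by rewrite count_nseq /= (negbTE ji).
Qed.

(** Only k' = k survives at 0: if k'_i < k_i the falling factorial vanishes, and if k'_i > k_i a
    positive power of 0 remains. *)
Lemma rsum_dmono0 (c : {ffun 'I_n -> nat} -> R) k :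
  rsum (fun k' => c k' * dmono k 0 k') = c k * (mfact k)%:R.
Proof.
rewrite (@rsum_single _ _ _ k) => [|k' kk'].
  rewrite /dmono /mfact natr_prod; congr (_ * _); apply: eq_bigr => i _.
  by rewrite ffactnn subnn expr0 mulr1.
have [i ki] : exists i, k' i != k i.
  by apply/existsP; rewrite -negb_forall; apply: contraNN kk' => /eqfunP/ffunP ->.
rewrite /dmono (bigD1 i)//= mxE.
have [lt|gt|eq] := ltngtP (k' i) (k i).
- by rewrite ffact_small// !mul0r mulr0.
- by rewrite expr0n subn_eq0 leqNgt gt /= mulr0 mul0r mulr0.
- by rewrite eq eqxx in ki.
Qed.

End MultivariatePowerSeries.

(** * The generating function *)

Section GeneratingFunction.
Context {R : realType}.

Lemma Re_mulrc (z : R[i]) (a : R) : complex.Re (z * a%:C) = complex.Re z * a.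
Proof. by case: z => u v; rewrite /= mulr0 subr0. Qed.

Lemma Im_mulrc (z : R[i]) (a : R) : complex.Im (z * a%:C) = complex.Im z * a.
Proof. by case: z => u v; rewrite /= mulr0 add0r mulrC. Qed.

Lemma normc_real (a : R) : normc a%:C = `|a|.
Proof. by rewrite /normc /= expr0n /= addr0 sqrtr_sqr. Qed.

Lemma normc_ge0 (z : R[i]) : 0 <= normc z.
Proof. by case: z => u v; rewrite sqrtr_ge0. Qed.

Lemma normc_mulrc (z : R[i]) (a : R) : normc (z * a%:C) = normc z * `|a|.
Proof. by rewrite normcM normc_real. Qed.

Lemma Re_le_normc (z : R[i]) : `|complex.Re z| <= normc z.
Proof.
by case: z => u v /=; rewrite -sqrtr_sqr ler_wsqrtr// lerDl sqr_ge0.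
Qed.

Lemma Im_le_normc (z : R[i]) : `|complex.Im z| <= normc z.
Proof.
by case: z => u v /=; rewrite -sqrtr_sqr ler_wsqrtr// lerDr sqr_ge0.
Qed.

Lemma normcX (z : R[i]) m : normc (z ^+ m) = normc z ^+ m.
Proof. by elim: m => [|m IH]; rewrite ?expr0 ?normc1// !exprS normcM IH. Qed.

Lemma enorm_ge0 m (y : 'rV[R]_m) : 0 <= enorm y.
Proof. exact: sqrtr_ge0. Qed.

Lemma coord_le_enorm m (y : 'rV[R]_m) i : `|y 0 i| <= enorm y.
Proof.
rewrite -sqrtr_sqr ler_wsqrtr// (bigD1 i)//= lerDl sumr_ge0// => j _.
exact: sqr_ge0.
Qed.

(** At y = 0 the quotient is 0 by the convention on inverses, so the Gegenbauer estimates apply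
    there without a separate case. *)
Lemma cos_enorm_le1 m (y : 'rV[R]_m) i : `|y 0 i / enorm y| <= 1.
Proof.
rewrite normrM normfV (ger0_norm (enorm_ge0 y)).
have := enorm_ge0 y; rewrite le_eqVlt => /predU1P[<-|y0].
  by rewrite invr0 mulr0.
by rewrite ler_pdivrMr// mul1r coord_le_enorm.
Qed.

Lemma enorm_cos m (y : 'rV[R]_m) i : enorm y * (y 0 i / enorm y) = y 0 i.
Proof.
have [y0|y0] := eqVneq (enorm y) 0; last by rewrite mulrC divfK.
rewrite y0 mul0r; apply/esym/eqP; rewrite -normr_le0 -y0.
exact: coord_le_enorm.
Qed.

Section EmbedFactor.
Variables (p j : nat) (y : 'rV[R]_p.+1).
Hypotheses (p2 : (2 <= p)%N) (y1 : enorm y <= 1).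
Let nu : R := p.+1%:R / 2 + j%:R - 1.

Let nu_gt0 : 0 < nu.
Proof.
(* Dimension at least 3 makes nu at least 1/2. *)
have : (3%:R : R) <= p.+1%:R by rewrite ler_nat.
have : 0 <= j%:R :> R by [].
by rewrite /nu; lra.
Qed.

Lemma embed_factor_series (h : R) : `|h| < 1 ->
  series (fun k => embed_factor j k y * h ^+ k) @ \oo -->
  ((1 - 2 * y 0 ord_max * h + h ^+ 2 * enorm y ^+ 2) `^ nu)^-1.
Proof.
move=> h1.
have yh : `|enorm y * h| < 1.
  rewrite normrM (ger0_norm (enorm_ge0 y)).
  by rewrite (le_lt_trans _ h1)// ler_piMl.
have := gegenbauerP nu_gt0 (cos_enorm_le1 y ord_max) yh.
rewrite (_ : 1 - _ + _ = 1 - 2 * y 0 ord_max * h + h ^+ 2 * enorm y ^+ 2); last first.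
  rewrite -[in RHS](enorm_cos y ord_max); ring.
suff -> : (fun k => embed_factor j k y * h ^+ k) =
    (fun k => (gegenbauer nu k).[y 0 ord_max / enorm y] * (enorm y * h) ^+ k) by [].
by apply/funext => k; rewrite exprMn /embed_factor mulrCA mulrA.
Qed.

(** The absolute values are dominated by a series with sum (1 - |h|)^(-2 nu), and 1 - |h| >= 1/2
    bounds this by 4^nu; as nu = m/2 - 1 + j, the part depending on j is 4^j. *)
Lemma embed_factor_abs_summ (h : R) : `|h| <= 2^-1 ->
  abs_summ (fun k => embed_factor j k y * h ^+ k) /\
  rsum (fun k => `|embed_factor j k y * h ^+ k|) <=
    4 `^ (p.+1%:R / 2 - 1) * 4 ^+ j.
Proof.
move=> h2.
have h01 : 0 <= `|h| < 1 by rewrite normr_ge0 /=; lra.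
have u0 k : 0 <= geg_bound nu k * `|h| ^+ k.
  by rewrite mulr_ge0 ?exprn_ge0// ltW// geg_bound_gt0.
have [su Eu] := ge0_series_cvg u0 (geg_bound_sum nu_gt0 h01).
have le k : `|embed_factor j k y * h ^+ k| <= geg_bound nu k * `|h| ^+ k.
  rewrite normrM normrX ler_wpM2r ?exprn_ge0// /embed_factor normrM normrX.
  rewrite (ger0_norm (enorm_ge0 y)) (@le_trans _ _ `|(gegenbauer nu k).[y 0 ord_max / enorm y]|)//.
    by rewrite ler_piMl// exprn_ile1// enorm_ge0.
  by rewrite gegenbauer_bound// cos_enorm_le1.
split.
  by apply: abs_summ_le su => k; rewrite (le_trans (le k))// ler_norm.
apply: (@le_trans _ _ (rsum (fun k => geg_bound nu k * `|h| ^+ k))).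
  by apply: ge0_le_rsum => // k; rewrite normr_ge0 le.
rewrite Eu.
have -> : 4 `^ (p.+1%:R / 2 - 1) * 4 ^+ j = (4 : R) `^ nu.
  rewrite -powR_mulrn// -powRD; last by apply/implyP => _; rewrite pnatr_eq0.
  by rewrite /nu; congr (_ `^ _); ring.
have -> : (4 : R) `^ nu = ((4^-1) `^ nu)^-1.
  by rewrite -[4^-1]powR_inv1// -powRrM mulN1r powRN invrK.
have hh : 4^-1 <= (1 - `|h|) ^+ 2 by nra.
rewrite lef_pV2 ?posrE ?powR_gt0//; last by apply: lt_le_trans hh.
by rewrite ge0_ler_powR ?nnegrE ?(ltW nu_gt0)// ?sqr_ge0// invr_ge0.
Qed.

End EmbedFactor.

(** * Splitting off the last variable and the last index *)

Section SplitLast.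
Variable p : nat.

Definition ffun_rcons (q : {ffun 'I_p -> nat} * nat) : {ffun 'I_p.+1 -> nat} :=
  [ffun i => if unlift ord_max i is Some j then q.1 j else q.2].

Definition ffun_belast (k : {ffun 'I_p.+1 -> nat}) : {ffun 'I_p -> nat} * nat :=
  ([ffun i => k (lift ord_max i)], k ord_max).

Lemma ffun_rcons_max q : ffun_rcons q ord_max = q.2.
Proof. by rewrite ffunE unlift_none. Qed.

Lemma ffun_rcons_lift q i : ffun_rcons q (lift ord_max i) = q.1 i.
Proof. by rewrite ffunE liftK. Qed.

Lemma widen_ord_lift (i : 'I_p) : widen_ord (leqnSn p) i = lift ord_max i.
Proof. by apply: val_inj; rewrite [RHS]lift_max. Qed.

Lemma ffun_rcons_bij : bijective ffun_rcons.
Proof.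
exists ffun_belast => [[k j]|k].
  rewrite /ffun_belast ffun_rcons_max; congr (_, _).
  by apply/ffunP => i; rewrite ffunE ffun_rcons_lift.
apply/ffunP => i; have [j|] := unliftP ord_max i => [->|->].
  by rewrite ffun_rcons_lift ffunE.
by rewrite ffun_rcons_max.
Qed.

End SplitLast.

Lemma prefix_rowE n r (x : 'rV[R]_n.+1) (i : 'I_r) (j : 'I_n.+1) :
  i = j :> nat -> prefix_row r x 0 i = x 0 j.
Proof. by move=> ij; rewrite mxE ij inord_val. Qed.

Lemma prefix_row_id n (x : 'rV[R]_n.+1) : prefix_row n.+1 x = x.
Proof. by apply/rowP => i; rewrite (@prefix_rowE _ _ _ _ i). Qed.

Lemma prefix_row_prefix n m r (x : 'rV[R]_n.+1) : (r <= m.+1)%N -> (m <= n)%N ->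
  prefix_row r (prefix_row m.+1 x) = prefix_row r x.
Proof.
move=> rm mn; apply/rowP => i.
have im : (i < m.+1)%N by exact: leq_trans rm.
have i' : (i < n.+1)%N by exact: leq_trans im _.
by rewrite (@prefix_rowE _ _ _ _ (Ordinal im))// !(@prefix_rowE _ _ _ _ (Ordinal i')).
Qed.

Lemma enorm_prefix_row n (x : 'rV[R]_n.+2) : enorm (prefix_row n.+1 x) <= enorm x.
Proof.
rewrite ler_wsqrtr// [leRHS]big_ord_recr /= ler_wpDr ?sqr_ge0//.
rewrite le_eqVlt; apply/orP; left; apply/eqP; apply: eq_bigr => i _.
by rewrite (@prefix_rowE _ _ _ _ (widen_ord (leqnSn _) i)).
Qed.

Lemma mpow_rcons p (h : 'rV[R]_p.+2) q :
  mpow h (ffun_rcons q) = mpow (prefix_row p.+1 h) q.1 * h 0 ord_max ^+ q.2.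
Proof.
rewrite /mpow big_ord_recr /= ffun_rcons_max; congr (_ * _).
apply: eq_bigr => i _; rewrite widen_ord_lift ffun_rcons_lift.
by rewrite (@prefix_rowE _ _ _ _ (lift ord_max i))// lift_max.
Qed.

(** The factors with r < m see only the first m - 1 coordinates and the indices before k_m; the last
    one meets k_2, ..., k_(m-1) only through their sum. *)
Lemma harm_rcons p s (x : 'rV[R]_p.+3) q :
  harm s (ffun_rcons q) x =
  harm s q.1 (prefix_row p.+2 x) * (embed_factor (\sum_i q.1 i)%N q.2 x)%:C.
Proof.
rewrite /harm big_mkcond big_ord_recr /= -big_mkcond /= mulrA; congr (_ * _); last first.
  rewrite ffun_rcons_max prefix_row_id.
  suff -> : (\sum_(j < p.+2 | (j < p.+1)%N) ffun_rcons q j = \sum_i q.1 i)%N by [].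
  rewrite big_mkcond big_ord_recr /= ltnn addn0 -big_mkcond.
  by apply: eq_big => i; rewrite ?ltn_ord// widen_ord_lift ffun_rcons_lift.
congr (_ * _).
  have o0 : ord0 = lift ord_max ord0 :> 'I_p.+2 by apply: val_inj; rewrite [RHS]lift_max.
  rewrite o0 ffun_rcons_lift; congr (harm2 _ _ _ _); apply/esym.
    exact: prefix_rowE.
  exact: prefix_rowE.
apply: eq_bigr => i i0; rewrite widen_ord_lift ffun_rcons_lift.
have -> : prefix_row i.+2 (prefix_row p.+2 x) = prefix_row i.+2 x.
  by apply: prefix_row_prefix; [rewrite ltnS; exact: ltn_ord|exact: leqnSn].
suff -> : (\sum_(j < p.+2 | (j < i)%N) ffun_rcons q j =
           \sum_(j < p.+1 | (j < i)%N) q.1 j)%N by [].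
rewrite big_mkcond big_ord_recr /= ltnNge (ltnW (ltn_ord i)) /= addn0 -big_mkcond /=.
by apply: eq_bigr => j _; rewrite widen_ord_lift ffun_rcons_lift.
Qed.

Lemma mpowZ m (h : 'rV[R]_m) (a : R) k :
  mpow (a *: h) k = a ^+ (\sum_i k i)%N * mpow h k.
Proof.
rewrite /mpow expr_sum -big_split /=; apply: eq_bigr => i _.
by rewrite mxE exprMn.
Qed.

Lemma gen_term_rcons p s (x : 'rV[R]_p.+3) h q :
  gen_term s x h (ffun_rcons q) =
  gen_term s (prefix_row p.+2 x) (prefix_row p.+1 h) q.1 *
  (embed_factor (\sum_i q.1 i)%N q.2 x * h 0 ord_max ^+ q.2)%:C.
Proof.
rewrite /gen_term harm_rcons mpow_rcons !rmorphM /=.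
by rewrite mulrACA; ring.
Qed.

(** Applied with a = 4 to absorb the growth of the inner sums, and with a = 1 / d in the
    recursion. *)
Lemma gen_termZ n s (x : 'rV[R]_n.+2) h (a : R) k :
  gen_term s x (a *: h) k = gen_term s x h k * (a ^+ (\sum_i k i)%N)%:C.
Proof. by rewrite /gen_term mpowZ rmorphM /=; ring. Qed.

(** These are the terms of the exponential series at |x1 + i x2| |h|, so the case m = 2 converges
    for every h. *)
Lemma abs_summ_harm2 s (x1 x2 h : R) :
  abs_summ (fun k => normc (harm2 s k x1 x2) * `|h| ^+ k).
Proof.
pose z : R[i] := x1 +i* ((-1) ^+ s * x2).
have E k : normc (harm2 s k x1 x2) * `|h| ^+ k = exp_coeff (normc z * `|h|) k.
  rewrite /harm2 normcM normcX normcV -/z exp_coeffE /= exprMn.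
  have -> : normc (k`!%:R : R[i]) = k`!%:R.
    by rewrite -(rmorph_nat (real_complex R)) normc_real normr_nat.
  by rewrite exprMn mulrAC mulrC.
under [fun k => _]eq_fun do rewrite E.
have pos k : 0 <= exp_coeff (normc z * `|h|) k.
  by rewrite exp_coeff_ge0// mulr_ge0// normc_ge0.
by have [] := ge0_series_cvg pos (is_cvg_series_exp_coeff (normc z * `|h|)).
Qed.

(* The factor 4 per variable pays for the bound 4 ^ j in embed_factor_abs_summ. *)
Definition gen_radius n : R := 4^-1 ^+ n / 2.

Lemma gen_radius_gt0 n : 0 < gen_radius n.
Proof. by rewrite divr_gt0// exprn_gt0. Qed.

Lemma gen_defined_radius n s (x : 'rV[R]_n.+2) (h : 'rV[R]_n.+1) :
  enorm x <= 1 -> polydisc (gen_radius n) h -> gen_defined s x h.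
Proof.
elim: n x h => [|p IH] x h x1 hr; rewrite /gen_defined /abs_summable.
  pose e (j : nat) : {ffun 'I_1 -> nat} := [ffun=> j].
  have be : bijective (fun k : {ffun 'I_1 -> nat} => k ord0).
    exists e => [k|j]; last by rewrite ffunE.
    by apply/ffunP => i; rewrite ffunE (ord1 i).
  have := abs_summ_bij be (abs_summ_harm2 s (x 0 ord0) (x 0 (lift ord0 ord0)) (h 0 ord0)).
  apply: abs_summ_le => k; rewrite /= /gen_term normc_mulrc.
  rewrite /harm big_pred0 => [|i]; last by rewrite (ord1 i).
  by rewrite mulr1 /mpow big_ord_recl big_ord0 mulr1 normrX.
suff : abs_summ (fun q => normc (gen_term s x h (ffun_rcons q))).
  have [e eK Ke] := ffun_rcons_bij p.+1.
  have be : bijective e by exists (@ffun_rcons p.+1).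
  move=> /(abs_summ_bij be); apply: abs_summ_le => k.
  by rewrite /= Ke.
have h2 : `|h 0 ord_max| <= 2^-1.
  apply/ltW/(lt_le_trans (hr ord_max)); rewrite ler_piMl ?invr_ge0//.
  by rewrite exprn_ile1// ?invr_ge0// invf_le1// ler1n.
have x'1 : enorm (prefix_row p.+2 x) <= 1 by exact: le_trans (enorm_prefix_row x) x1.
set x' := prefix_row p.+2 x in x'1 *; set h' := prefix_row p.+1 h.
set K : R := 4 `^ (p.+3%:R / 2 - 1).
have K0 : 0 <= K by exact: powR_ge0.
have ef k := @embed_factor_abs_summ p.+2 k x isT x1 _ h2.
have E q : normc (gen_term s x h (ffun_rcons q)) =
    normc (gen_term s x' h' q.1) *
    `|embed_factor (\sum_i q.1 i)%N q.2 x * h 0 ord_max ^+ q.2|.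
  by rewrite gen_term_rcons normc_mulrc.
apply: abs_summ_pairP => [k|].
  have [sk _] := ef (\sum_i k i)%N.
  apply: abs_summ_le (abs_summZ (normc (gen_term s x' h' k)) sk) => j.
  by rewrite E !normrM !normr_id.
(* The inner sums are at most K 4^(k_2 + ... + k_(m-1)); the power of 4 goes into the argument, and
   4 h' lies in the polydisc of the previous dimension. *)
have : gen_defined s x' (4 *: h').
  apply: IH => // i; rewrite mxE (@prefix_rowE _ _ _ _ (lift ord_max i)); last first.
    by rewrite lift_max.
  have := hr (lift ord_max i); rewrite /gen_radius exprS.
  by rewrite normrM ger0_norm// => ?; lra.
move=> /(abs_summZ K); apply: abs_summ_le => k.
have [sk lek] := ef (\sum_i k i)%N.
rewrite ger0_norm; last by apply: rsum_ge0.
rewrite ger0_norm; last by rewrite mulr_ge0// normc_ge0.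
rewrite [leLHS](_ : _ = normc (gen_term s x' h' k) *
    rsum (fun j => `|embed_factor (\sum_i k i)%N j x * h 0 ord_max ^+ j|)); last first.
  rewrite -rsumZ; last exact: abs_summ_norm.
  by apply: eq_rsum => j; rewrite E ger0_norm ?mulr_ge0 ?normc_ge0.
rewrite gen_termZ normc_mulrc ger0_norm ?exprn_ge0// mulrCA.
by rewrite ler_wpM2l// normc_ge0.
Qed.

Lemma gen_denom_gt0 n (x : 'rV[R]_n.+2) (h : 'rV[R]_n.+1) :
  enorm x <= 1 -> `|h 0 ord_max| < 1 -> 0 < gen_denom x h.
Proof.
move=> x1 h1; rewrite /gen_denom.
have := @geg_denom_gt0 R (x 0 ord_max / enorm x) (enorm x * h 0 ord_max) (cos_enorm_le1 _ _).
rewrite normrM (ger0_norm (enorm_ge0 x)) (le_lt_trans _ h1) ?ler_piMl// => /(_ isT).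
set u := x 0 ord_max / enorm x => H.
by rewrite -(enorm_cos x ord_max) -/u (_ : _ + _ = 1 - 2 * u * (enorm x * h 0 ord_max) +
  (enorm x * h 0 ord_max) ^+ 2)//; ring.
Qed.

Lemma gen_fun_rec p s (x : 'rV[R]_p.+3) (h : 'rV[R]_p.+2) :
  enorm x <= 1 -> polydisc (gen_radius p.+1) h ->
  let d := gen_denom x h in
  let x' := prefix_row p.+2 x in
  let h' := d^-1 *: prefix_row p.+1 h in
  gen_defined s x' h' /\
  gen_fun s x h = (d `^ (1 - p.+3%:R / 2))%:C * gen_fun s x' h'.
Proof.
move=> x1 hr d x' h'.
have h1 : `|h 0 ord_max| < 1.
  apply: (lt_le_trans (hr ord_max)); rewrite /gen_radius ler_pdivrMr// mul1r.
  by rewrite (@le_trans _ _ 1)// ?ler1n// exprn_ile1// ?invr_ge0// invf_le1// ler1n.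
have d0 : 0 < d by exact: gen_denom_gt0.
set c := d `^ (1 - p.+3%:R / 2).
have c0 : 0 < c by exact: powR_gt0.
pose E (k : {ffun 'I_p.+1 -> nat}) j := embed_factor (\sum_i k i)%N j x * h 0 ord_max ^+ j.
pose T (k : {ffun 'I_p.+1 -> nat}) := gen_term s x' (prefix_row p.+1 h) k.
have gd := gen_defined_radius s x1 hr.
have bij := ffun_rcons_bij p.+1.
have sN : abs_summ (fun q : {ffun 'I_p.+1 -> nat} * nat => normc (T q.1) * `|E q.1 q.2|).
  have := abs_summ_bij bij gd.
  by apply: abs_summ_le => q; rewrite /= gen_term_rcons normc_mulrc.
(* Joint summability controls the inner family only where T k is nonzero; the other k contribute 0
   to both sides. *)
have sE k : normc (T k) != 0 -> abs_summ (E k).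
  move=> Tk; have := abs_summ_pair1 k sN.
  move=> /(abs_summZ (normc (T k))^-1); apply: abs_summ_le => j /=.
  by rewrite mulKf// normr_id.
have Ed k : d^-1 ^+ (\sum_i k i)%N * c = ((d `^ (p.+3%:R / 2 + (\sum_i k i)%:R - 1))^-1).
  rewrite -powRN -[d^-1]powR_inv1 ?ltW// -powR_mulrn ?powR_ge0// -powRrM -powRD.
    by congr (_ `^ _); ring.
  by apply/implyP => _; rewrite gt_eqF.
have cE k : series (E k) @ \oo --> d^-1 ^+ (\sum_i k i)%N * c.
  by rewrite Ed; exact: (@embed_factor_series p.+2 _ x isT x1 _ h1).
have rE k : normc (T k) != 0 -> rsum (E k) = d^-1 ^+ (\sum_i k i)%N * c.
  move=> /sE /rsum_series_cvg /(cvg_lim (@Rhausdorff R)) <-.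
  exact/(cvg_lim (@Rhausdorff R)).
have T'E k : gen_term s x' h' k = T k * (d^-1 ^+ (\sum_i k i)%N)%:C by exact: gen_termZ.
(* Summability is inherited from the left side: c times the norm of the k-th term is |T k| times
   |sum_j E k j|, at most the k-th row sum of absolute values. *)
have gd' : gen_defined s x' h'.
  have := abs_summ_pair2 sN => /(abs_summZ c^-1); apply: abs_summ_le => k.
  rewrite [leRHS]ger0_norm; last first.
    by rewrite mulr_ge0 ?invr_ge0 ?(ltW c0)// rsum_ge0.
  rewrite T'E normc_mulrc ger0_norm ?mulr_ge0 ?normc_ge0//.
  have [->|Tk] := eqVneq (normc (T k)) 0.
    by rewrite mul0r mulr_ge0 ?invr_ge0 ?(ltW c0)// rsum_ge0.
  rewrite (_ : rsum _ = normc (T k) * rsum (fun j => `|E k j|)); last first.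
    rewrite -rsumZ; last exact/abs_summ_norm/sE.
    by apply: eq_rsum => j; rewrite /= ger0_norm ?mulr_ge0 ?normc_ge0.
  rewrite mulrCA ler_wpM2l ?normc_ge0// mulrC ler_pdivlMr//.
  rewrite -[X in _ * X](gtr0_norm c0) -normrM -rE//.
  exact/ler_norm_rsum/sE.
split=> //.
(* f stands for Re and Im: both commute with real factors and are dominated by the norm, which is
   all that the real Fubini theorem needs here. *)
have part (f : R[i] -> R) : (forall z (a : R), f (z * a%:C) = f z * a) ->
    (forall z, `|f z| <= normc z) ->
    rsum (fun k => f (gen_term s x h k)) = c * rsum (fun k => f (gen_term s x' h' k)).
  move=> fM fle.
  have sf : abs_summ (fun q => f (gen_term s x h (ffun_rcons q))).
    have := abs_summ_bij bij gd; apply: abs_summ_le => q /=.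
    by rewrite (ger0_norm (normc_ge0 _)).
  have sf' : abs_summ (fun k => f (gen_term s x' h' k)).
    by move: gd'; apply: abs_summ_le => k; rewrite (ger0_norm (normc_ge0 _)).
  rewrite (rsum_bij _ bij) rsum_pair// -rsumZ//; apply: eq_rsum => k.
  under eq_rsum do rewrite /= gen_term_rcons fM.
  rewrite T'E fM -/(T k) -/(E k).
  have [Tk|Tk] := eqVneq (normc (T k)) 0.
    have -> : f (T k) = 0 by apply/eqP; rewrite -normr_le0 -Tk.
    rewrite mul0r mulr0; under eq_rsum do rewrite mul0r.
    by rewrite (@rsum_single _ _ _ 0%N).
  by rewrite rsumZ ?rE//; [ring|exact: sE].
rewrite /gen_fun /csum (part _ Re_mulrc Re_le_normc) (part _ Im_mulrc Im_le_normc).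
by apply/eqP; rewrite eq_complex /= !mul0r subr0 addr0 !eqxx.
Qed.

Lemma gen_fun_derivs n s (k : {ffun 'I_n.+1 -> nat}) (x : 'rV[R]_n.+2) :
  enorm x <= 1 ->
  mpderivable k (gen_fun s x) 0 /\
  mpderiv k (gen_fun s x) 0 = (mfact k)%:R * harm s k x.
Proof.
move=> x1.
have P0 : polydisc (gen_radius n) (0 : 'rV[R]_n.+1).
  by move=> i; rewrite mxE normr0 gen_radius_gt0.
have cnt : (fun i => count_mem i (mdirs k)) = k by apply/funext => i; exact: count_mdirs.
have part (f : R[i] -> R) : (forall z (a : R), f (z * a%:C) = f z * a) ->
    (forall z, `|f z| <= normc z) ->
    let F := fun b => rsum (fun k' => f (gen_term s x b k')) in
    pderivable F (mdirs k) 0 /\ pderivs F (mdirs k) 0 = (mfact k)%:R * f (harm s k x).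
  move=> fM fle F.
  have FE : F = fun b => rsum (fun k' => f (harm s k' x) * mpow b k').
    by apply/funext => b; apply: eq_rsum => k'; rewrite fM.
  have sF b : polydisc (gen_radius n) b ->
      abs_summ (fun k' => f (harm s k' x) * mpow b k').
    move=> /(gen_defined_radius s x1); apply: abs_summ_le => k'.
    by rewrite (ger0_norm (normc_ge0 _)) -fM.
  rewrite FE; have [_ dF ->] := pderivs_rsum sF (mdirs k) P0; split=> //.
  by rewrite cnt rsum_dmono0 mulrC.
have [dRe eRe] := part _ Re_mulrc Re_le_normc.
have [dIm eIm] := part _ Im_mulrc Im_le_normc.
split; first by split.
rewrite /mpderiv eRe eIm -(rmorph_nat (real_complex R)).
case: (harm s k x) => u v; apply/eqP.
by rewrite eq_complex /= !mul0r subr0 addr0 !eqxx.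
Qed.

End GeneratingFunction.

Theorem theorem1 (R : realType) (n : nat) :
  exists U : set 'rV[R]_n.+1, nbhs (0 : 'rV[R]_n.+1) U /\
  forall s : bool,
    (forall (x : 'rV[R]_n.+2) (h : 'rV[R]_n.+1),
       enorm x <= 1 -> U h -> gen_defined s x h) /\
    (forall (k : {ffun 'I_n.+1 -> nat}) (x : 'rV[R]_n.+2),
       enorm x <= 1 ->
       mpderivable k (gen_fun s x) 0 /\
       harm s k x = (mfact k)%:R^-1 * mpderiv k (gen_fun s x) 0) /\
    ((0 < n)%N ->
     forall (x : 'rV[R]_n.+2) (h : 'rV[R]_n.+1),
       enorm x <= 1 -> U h ->
       let d := gen_denom x h in
       let x' : 'rV[R]_n.-1.+2 := prefix_row n.-1.+2 x in
       let h' : 'rV[R]_n.-1.+1 := d^-1 *: prefix_row n.-1.+1 h in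
       gen_defined s x' h' /\
       gen_fun s x h = (d `^ (1 - n.+2%:R / 2))%:C * gen_fun s x' h').
Proof.
exists [set h | polydisc (gen_radius n) h]; split.
  by apply: nbhs_polydisc => i; rewrite mxE normr0 gen_radius_gt0.
move=> s; split; first by move=> x h; exact: gen_defined_radius.
split.
  move=> k x x1; have [dk ->] := gen_fun_derivs s k x1; split=> //.
  by rewrite mulKf// pnatr_eq0 -lt0n prodn_gt0// => i; exact: fact_gt0.
by case: n => // p _ x h; exact: gen_fun_rec.
Qed.
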